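(* Let $\Bbbk$ be a field, $R=\Bbbk[x_1,\ldots,x_d]$ ($d\ge1$) the standard graded polynomial ring and $\mathfrak m=(x_1,\ldots,x_d)$. Let $\mathbb J(1)=\{J(1)_n\}_{n\in\mathbb N},\ldots,\mathbb J(r)=\{J(r)_n\}_{n\in\mathbb N}$ be (not necessarily Noetherian) graded families of $\mathfrak m$-primary monomial ideals in $R$, and let $c\ge2$ be an integer with $J(i)_1\supset\mathfrak m^{c-1}$ for all $1\le i\le r$. Then the function $$F(n_1,\ldots,n_r)=\lim_{m\to\infty}\frac{\dim_{\Bbbk}\big(R/J(1)_{mn_1}\cdots J(r)_{mn_r}\big)}{m^d}$$ is equal to a homogeneous polynomial $G(\mathbf n)=G(n_1,\ldots,n_r)$ of total degree $d$ with real coefficients for all $\mathbf n=(n_1,\ldots,n_r)\in\mathbb N^r$. Explicitly, $$G(\mathbf n)=\sum_{|\mathbf d|=d}\frac1{\mathbf d!}\Big(c^d-\mathrm{MV}_d\big(\Delta(\Gamma)_{\mathbf d}\big)\Big)\,\mathbf n^{\mathbf d},$$ where $\Delta(\Gamma)=(\Delta(\Gamma_{\mathbf e_1}),\ldots,\Delta(\Gamma_{\mathbf e_r}))$ is the sequence of Newton-Okounkov bodies defined in the context.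
   Context: $\mathbb N$ contains $0$; for $\mathbf d\in\mathbb N^r$: $|\mathbf d|=d_1+\cdots+d_r$, $\mathbf d!=d_1!\cdots d_r!$, $\mathbf n^{\mathbf d}=n_1^{d_1}\cdots n_r^{d_r}$; $\mathbf e_i$ is the $i$-th standard basis vector of $\mathbb N^r$. A graded family of $\mathfrak m$-primary monomial ideals is a sequence $\{J_n\}_{n\in\mathbb N}$ of monomial ideals with $J_0=R$, $J_iJ_j\subseteq J_{i+j}$ for all $i,j$, and $J_n$ $\mathfrak m$-primary for all $n>0$. It is Noetherian if $\bigoplus_nJ_nt^n\subseteq R[t]$ is Noetherian. Write $\mathbf J_{\mathbf n}=J(1)_{n_1}\cdots J(r)_{n_r}$ and, for $\mathbf n\in\mathbb N^r$, define the semigroup $$\Gamma_{\mathbf n}=\{(\mathbf m,m)\in\mathbb N^d\times\mathbb N\mid\mathbf x^{\mathbf m}\in\mathbf J_{m\mathbf n},\ |\mathbf m|\le cm|\mathbf n|\}.$$ For such a semigroup $S\subset\mathbb N^{d+1}$, $\mathrm{Con}(S)\subset\mathbb R^{d+1}$ is the closure of the convex cone generated by $S$ and $\Delta(S)=\mathrm{Con}(S)\cap(\mathbb R^d\times\{1\})$ is its Newton-Okounkov body, regarded as a convex body in $\mathbb R^d$ via projection to the first $d$ coordinates. Mixed volumes: $\mathrm{MV}_d$ is the symmetric function of $d$ convex bodies in $\mathbb R^d$ determined by $\mathrm{Vol}_d(\lambda_1K_1+\cdots+\lambda_rK_r)=\sum_{|\mathbf d|=d}\frac1{\mathbf d!}\mathrm{MV}_d(\mathbf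 K_{\mathbf d})\lambda_1^{d_1}\cdots\lambda_r^{d_r}$ for all $\lambda_i\ge0$, where $\mathbf K=(K_1,\ldots,K_r)$ and $\mathbf K_{\mathbf d}$ is the multiset with $d_i$ copies of $K_i$ for each $1\le i\le r$. *)

(* Defs.v *)
From mathcomp Require Import all_boot all_order all_algebra perm.
From mathcomp Require Import all_classical all_reals all_analysis.
(* The notations of mpoly clash with those of the analysis library: below,
   [mpoly d k] is {mpoly k[d]}, [multinom d] is the type 'X_{1..d} of exponent
   vectors (also used for N^d), [bmultinom r b] its finite subtype of vectors
   of degree < b, and [mnm1 i] is the standard basis vector U_(i). *)
From mathcomp Require Export -(notations) mpoly.
Import Order.TTheory GRing.Theory Num.Theory.
Import numFieldNormedType.Exports.

Set Implicit Arguments.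
Unset Strict Implicit.
Unset Printing Implicit Defensive.

Local Open Scope classical_set_scope.
Local Open Scope ring_scope.

Section MonomialIdeals.
Variables (k : fieldType) (d : nat).
Implicit Types (I J : set (mpoly d k)).

Definition is_ideal I : Prop :=
  [/\ I 0, forall p q, I p -> I q -> I (p + q)
    & forall a p, I p -> I (a * p)].

Definition ideal_gen (A : set (mpoly d k)) : set (mpoly d k) :=
  smallest is_ideal A.

Definition monomial_ideal I : Prop :=
  exists A : set (multinom d), I = ideal_gen [set mpolyX k m | m in A].

Definition max_ideal : set (mpoly d k) :=
  ideal_gen [set mpolyX k (mnm1 i) | i in [set: 'I_d]].

Definition radical I : set (mpoly d k) := [set p | exists n, I (p ^+ n)].

Definition primary_ideal I : Prop :=
  [/\ is_ideal I, I <> setT & forall p q, I (p * q) -> I p \/ radical I q].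

Definition m_primary I : Prop := primary_ideal I /\ radical I = max_ideal.

Definition ideal_mul I J : set (mpoly d k) :=
  ideal_gen [set x | exists p q, [/\ I p, J q & x = p * q]].

Definition ideal_prod (r : nat) (I : 'I_r -> set (mpoly d k)) :
    set (mpoly d k) :=
  \big[ideal_mul/setT]_(i < r) I i.

Definition ideal_exp I (n : nat) : set (mpoly d k) :=
  ideal_prod (fun _ : 'I_n => I).

Definition graded_family (J : nat -> set (mpoly d k)) : Prop :=
  [/\ J 0%N = setT, forall n, monomial_ideal (J n),
      forall i j, ideal_mul (J i) (J j) `<=` J (i + j)%N
    & forall n, (0 < n)%N -> m_primary (J n)].

(* The residue classes of b form a k-basis of the quotient by I. *)
Definition quotient_basis I (N : nat) (b : 'I_N -> mpoly d k) : Prop :=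
  forall p, exists! a : 'I_N -> k, I (p - \sum_i a i *: b i).

(* dim_k (k[x_1, .., x_d] / I); it is set to 0 if the dimension is infinite. *)
Definition quotient_dim I : nat :=
  xget 0%N [set N | exists b : 'I_N -> mpoly d k, quotient_basis I b].

Variable r : nat.

Definition mixed_ideal (J : 'I_r -> nat -> set (mpoly d k))
    (n : 'I_r -> nat) : set (mpoly d k) :=
  ideal_prod (fun i => J i (n i)).

Definition Gamma (c : nat) (J : 'I_r -> nat -> set (mpoly d k))
    (n : multinom r) : set (multinom d * nat) :=
  [set q | mixed_ideal J (fun i => q.2 * n i)%N (mpolyX k q.1) /\
           (mdeg q.1 <= c * q.2 * mdeg n)%N].

End MonomialIdeals.

Arguments max_ideal : clear implicits.

Section ConvexGeometry.
Variables (R : realType) (d : nat).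

Definition embed_point (q : multinom d * nat) : 'rV[R]_d * R :=
  (\row_j (q.1 j)%:R, q.2%:R).

Definition convex_cone (A : set ('rV[R]_d * R)) : set ('rV[R]_d * R) :=
  [set x | exists N (a : 'I_N -> R) (s : 'I_N -> 'rV[R]_d * R),
     (forall i, 0 <= a i /\ A (s i)) /\ x = \sum_i a i *: s i].

Definition Con (S : set (multinom d * nat)) : set ('rV[R]_d * R) :=
  closure (convex_cone [set embed_point q | q in S]).

Definition Delta (S : set (multinom d * nat)) : set 'rV[R]_d :=
  [set x | Con S (x, 1)].

Definition convex_body (K : set 'rV[R]_d) : Prop :=
  [/\ K !=set0, compact K & convex_set K].

(* Lebesgue outer measure, by countable covers with closed boxes (for d > 0);
   convex bodies being measurable, it gives their d-dimensional volume. *)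
Definition lebesgue_outer (A : set 'rV[R]_d) : \bar R :=
  ereal_inf [set v | exists a b : nat -> 'rV[R]_d,
    [/\ forall n i, a n 0 i <= b n 0 i,
        A `<=` \bigcup_n [set x | forall i, a n 0 i <= x 0 i <= b n 0 i]
      & v = (\sum_(0 <= n <oo) (\prod_(i < d) (b n 0 i - a n 0 i))%:E)%E]].

Definition Vol (A : set 'rV[R]_d) : R := fine (lebesgue_outer A).

Definition minkowski_comb (r : nat) (l : 'I_r -> R) (K : 'I_r -> set 'rV[R]_d) :
    set 'rV[R]_d :=
  [set x | exists2 y : 'I_r -> 'rV[R]_d,
     forall i, K i (y i) & x = \sum_i l i *: y i].

(* The multiset with a_i copies of K_i, listed as a d-tuple when |a| = d. *)
Definition repeat_bodies (r : nat) (K : 'I_r -> set 'rV[R]_d)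
    (a : multinom r) : 'I_d -> set 'rV[R]_d :=
  fun j => nth set0 (flatten [seq nseq (a i) (K i) | i <- enum 'I_r]) j.

Definition mnm_fact (r : nat) (a : multinom r) : nat := (\prod_(i < r) (a i)`!)%N.

Definition is_mixed_volume (MV : ('I_d -> set 'rV[R]_d) -> R) : Prop :=
  (forall (K : 'I_d -> set 'rV[R]_d) (s : {perm 'I_d}),
     (forall i, convex_body (K i)) -> MV (fun i => K (s i)) = MV K) /\
  (forall (r : nat) (K : 'I_r -> set 'rV[R]_d) (l : 'I_r -> R),
     (forall i, convex_body (K i)) -> (forall i, 0 <= l i) ->
     Vol (minkowski_comb l K) =
       \sum_(a : bmultinom r d.+1 | mdeg a == d)
         (mnm_fact a)%:R^-1 * MV (repeat_bodies K a) * \prod_(i < r) l i ^+ a i).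

(* By Minkowski's theorem a function satisfying is_mixed_volume exists (d > 0),
   and its values on tuples of convex bodies are unique; mixed_volume is a
   choice of such a function. *)
Definition mixed_volume : ('I_d -> set 'rV[R]_d) -> R :=
  xget (fun=> 0) is_mixed_volume.

End ConvexGeometry.

(* Main.v *)
Require Import Defs.
From mathcomp Require Import all_boot all_order all_algebra perm.
From mathcomp Require Import all_classical all_reals all_analysis.
From mathcomp Require Import finmap zify ring lra.
Import Order.TTheory GRing.Theory Num.Theory.
Import numFieldNormedType.Exports.
Local Open Scope classical_set_scope.
Local Open Scope ring_scope.

Set Implicit Arguments.
Unset Strict Implicit.
Unset Printing Implicit Defensive.

(** The colength of a monomial ideal is the number of exponents outside it, so
    the theorem is about counting lattice points. Write A for c |n| and K for
    the Minkowski combination of the bodies Delta(Gamma_(e_i)) with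
    coefficients n_i. All exponents of degree at least (c-1) m |n| lie in the
    m-th mixed ideal, hence its colength is the number of exponents of degree
    at most A m, which grows like (A m)^d / d!, minus the number of exponents
    of the ideal of degree at most A m. The latter grows like m^d Vol K: such
    an exponent, divided by m, is a point of K (mixed_in_body; the factors can
    be rebalanced so that the i-th one has degree at most c m n_i), and
    conversely an exponent slightly above m z, with z in K, lies in the ideal
    (above_body_mixed). Thus the limit is A^d / d! - Vol K (cvg_colength), and
    the defining formula of mixed volumes together with the multinomial formula
    (sum_content) turns this into the announced polynomial in n.

    This last step needs Minkowski's theorem that mixed volumes exist, which is
    proved here by counting as well. A set is compared with the set of integer
    parts of its dilates: the unit cubes at these points cover the dilate, so
    their number bounds the volume from above (Vol_le_floors), and a finite
    subcover by boxes shows that a compact set, even slightly thickened, has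
    not many more lattice points than its volume tells (thick_le_Vol). If A_i
    consists of the integer points close to N K_i, then the sumset of m_i
    copies of each A_i is squeezed between two such sets of lattice points
    (floors_le_sumset, sumset_sub_thick). By the argument of Nathanson and
    Ruzsa for Khovanskii's theorem (eventually_poly_weighted_sums), the
    cardinality of such sumsets is polynomial in large m_i. Its degree d part,
    divided by N^d, therefore tends to the volume of the Minkowski combination
    (Vol_approx). Homogeneous polynomials of degree d satisfy a polarization
    identity (polarization) which involves finitely many values and so passes
    to this limit: the volume polynomial is recovered from the alternating sums
    mixvol, and these are the mixed volumes (is_mixed_volume_mixvol). *)

(** * Cardinality of finite sets *)

(** Cardinality as a natural number, a junk value for infinite sets; this is why
    finiteness accompanies most counts below. *)
Definition ncard {T : choiceType} (A : set T) : nat := #|` fset_set A|.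

Section Counting.
Context {T U : choiceType}.
Implicit Types A B : set T.

Lemma ncard_le A B : finite_set B -> A `<=` B -> (ncard A <= ncard B)%N.
Proof.
move=> fB AB; apply: fsubset_leq_card.
by rewrite -fset_set_sub//; exact: sub_finite_set AB fB.
Qed.

Lemma ncard_image_le (f : T -> U) A :
  finite_set A -> (ncard (f @` A) <= ncard A)%N.
Proof. by move=> fA; rewrite /ncard fset_set_image// leq_imfset_card. Qed.

Lemma ncard_inj (f : T -> U) A : finite_set A ->
  {in A &, injective f} -> ncard (f @` A) = ncard A.
Proof.
move=> fA fi; rewrite /ncard fset_set_image// card_in_imfset//=.
by move=> x y; rewrite !in_fset_set//; exact: fi.
Qed.

Lemma ncardID A B : finite_set A ->
  ncard A = (ncard (A `&` B) + ncard (A `&` ~` B))%N.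
Proof.
move=> fA; have fAB : finite_set (A `&` B) by apply: finite_setI; left.
have fAC : finite_set (A `&` ~` B) by apply: finite_setI; left.
rewrite {1}(_ : A = (A `&` B) `|` (A `&` ~` B)); last by rewrite -setIUr setUv setIT.
rewrite /ncard fset_setU// cardfsU -fset_setI// setIACA setICr setI0.
by rewrite fset_set0 cardfs0 subn0.
Qed.

End Counting.

Lemma ncard_fin (T : finType) (P : pred T) : ncard [set x | P x] = #|P|.
Proof.
have -> : [set x | P x] = [set` [fset x | x in P]%fset].
  by apply/seteqP; split=> x /=; rewrite !inE.
by rewrite /ncard set_fsetK card_imfset//= -cardE.
Qed.

(** * Dickson's lemma and eventually polynomial functions *)

(** The statement for the coordinates t :: s follows from the one for s: a finite
    set of elements L0 dominates P on s, and the elements x of P that are not above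
    L0 on the coordinate t have x t < N; for each of these finitely many values
    the induction hypothesis gives another finite set. *)
Lemma dickson (E T : eqType) (v : E -> T -> nat) (s : seq T) (P : set E) :
  exists L : seq E, (forall l, l \in L -> P l) /\
    forall x, P x -> exists2 l, l \in L & forall t, t \in s -> (v l t <= v x t)%N.
Proof.
elim: s P => [|t s IHs] P.
  have [[x0 Px0]|nP] := pselect (exists x, P x); last first.
    by exists [::]; split=> // x Px; case: nP; exists x.
  exists [:: x0]; split=> [l|x Px]; first by rewrite inE => /eqP->.
  by exists x0; rewrite ?inE.
have [L0 [L0P L0b]] := IHs P.
have /choice[F FP] : forall a : nat, exists L : seq E,
    (forall l, l \in L -> P l /\ v l t = a) /\
    forall x, P x -> v x t = a -> exists2 l, l \in L &
      forall u, u \in s -> (v l u <= v x u)%N.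
  move=> a; have [L [LP Lb]] := IHs [set x | P x /\ v x t = a].
  by exists L; split=> // x Px xa; exact: Lb.
pose N := (\max_(l <- L0) v l t)%N.
exists (L0 ++ flatten [seq F a | a <- iota 0 N]); split=> [l|x Px].
  rewrite mem_cat => /orP[/L0P//|/flattenP[_ /mapP[a _ ->]] la].
  by have [/(_ _ la)[]] := FP a.
have [xN|Nx] := ltnP (v x t) N.
  have [_ /(_ _ Px erefl)[l lF lx]] := FP (v x t).
  exists l => [|u].
    rewrite mem_cat; apply/orP; right; apply/flattenP; exists (F (v x t)) => //.
    by apply/mapP; exists (v x t); rewrite // mem_iota add0n.
  rewrite inE => /orP[/eqP->|/lx//].
  by have [/(_ _ lF)[_ ->]] := FP (v x t).
have [l lL lx] := L0b x Px; exists l; first by rewrite mem_cat lL.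
move=> u; rewrite inE => /orP[/eqP->|/lx//].
by apply: leq_trans Nx; rewrite /N (big_rem l)//= leq_max leqnn.
Qed.

Section EventuallyPolynomial.
Variables (R : realType) (r : nat).

(** The threshold q bounds all variables at once: counting functions of sumsets are
    polynomial only on the translated orthant where every variable is large. *)
Definition eventually_poly (f : ('I_r -> nat) -> nat) : Prop :=
  exists q (P : mpoly r R), forall n, (forall i, (q <= n i)%N) ->
    (f n)%:R = meval (fun i => (n i)%:R) P.

(** The difference is stated additively because the counts are natural numbers. *)
Lemma eventually_polyB f g h : (forall n, f n = g n + h n)%N ->
  eventually_poly f -> eventually_poly g -> eventually_poly h.
Proof.
move=> fgh [q [P fP]] [q' [P' gP']]; exists (maxn q q'), (P - P') => n qn.
have q1 i : (q <= n i)%N by apply: leq_trans (qn i); rewrite leq_maxl.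
have q2 i : (q' <= n i)%N by apply: leq_trans (qn i); rewrite leq_maxr.
by rewrite mevalB; have := fP n q1; have := gP' n q2; rewrite fgh natrD => <- <-; rewrite addrC addKr.
Qed.

Lemma poly_prod_bin k (p : 'I_r -> nat) :
  exists P : mpoly r R, forall n : 'I_r -> nat, (forall i, (p i <= n i)%N) ->
   (\prod_i 'C(k + (n i - p i), k))%N%:R = meval (fun i => (n i)%:R) P.
Proof.
exists (\prod_i (mpolyC r (k`!%:R^-1) * \prod_(j < k)
   (mpolyX R (mnm1 i) + mpolyC r (k%:R - (p i)%:R - j%:R)))).
move=> n pn; rewrite natr_prod [RHS]rmorph_prod; apply: eq_bigr => i _.
rewrite [LHS]/= [RHS]mevalM mevalC rmorph_prod.
under eq_bigr do rewrite /= mevalD mevalXU mevalC.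
apply: (@mulfI _ (k`!%:R)); first by rewrite pnatr_eq0 -lt0n fact_gt0.
rewrite mulVKf; last by rewrite pnatr_eq0 -lt0n fact_gt0.
rewrite -natrM mulnC bin_ffact ffact_prod natr_prod; apply: eq_bigr => j _.
have := pn i; have := ltn_ord j; move=> jk pni.
by rewrite natrB ?natrD ?natrB//; [ring|lia].
Qed.

End EventuallyPolynomial.

(** * Polynomial growth of sumsets *)

Section Sumsets.
Variables (R : realType) (r k : nat) (G : zmodType) (v : 'I_r * 'I_k.+1 -> G).
Local Notation T := ('I_r * 'I_k.+1)%type.
Local Notation expo := {ffun T -> nat}.
Implicit Types (x y p : expo) (n : 'I_r -> nat).

Definition expo_le x y := forall t, (x t <= y t)%N.
Definition expo_add x y : expo := [ffun t => x t + y t]%N.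
Definition expo_sub x y : expo := [ffun t => x t - y t]%N.
Definition expo_sup x y : expo := [ffun t => maxn (x t) (y t)].
(** The index (i, j) stands for the j-th generator of the i-th set A_i, and an
    exponent x prescribes how often each generator is used; the color degree is the
    number of summands taken from A_i. *)
Definition color_degree x (i : 'I_r) : nat := (\sum_j x (i, j))%N.
Definition weighted_sum x : G := \sum_t v t *+ x t.
Definition weighted_sums n : set G := [set weighted_sum x | x in [set x | color_degree x =1 n]].

Lemma color_degreeD x y i : color_degree (expo_add x y) i = (color_degree x i + color_degree y i)%N.
Proof. by rewrite /color_degree -big_split; apply: eq_bigr => j _; rewrite ffunE. Qed.

Lemma weighted_sumD x y : weighted_sum (expo_add x y) = weighted_sum x + weighted_sum y.
Proof. by rewrite /weighted_sum -big_split; apply: eq_bigr => j _; rewrite ffunE mulrnDr. Qed.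

Lemma expo_subK p x : expo_le p x -> expo_add (expo_sub x p) p = x.
Proof. by move=> px; apply/ffunP => t; rewrite !ffunE subnK. Qed.

Lemma leq_color_degree x i j : (x (i, j) <= color_degree x i)%N.
Proof. by rewrite /color_degree (bigD1 j)//= leq_addr. Qed.

Lemma finite_color_degree n : finite_set [set x | color_degree x =1 n].
Proof.
pose b := (\max_i n i)%N.
pose f (g : {ffun T -> 'I_b.+1}) : expo := [ffun t => g t : nat].
apply: (@sub_finite_set _ _ (range f)); last by apply: finite_image; exact: finite_finset.
move=> x /= xn; exists [ffun t => inord (x t)] => //; apply/ffunP => -[i j].
rewrite !ffunE inordK// ltnS (leq_trans (leq_color_degree x i j))// xn.
exact: (leq_bigmax i).
Qed.

(** The common bound b makes the compositions of different integers live in the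
    same finite type, as is needed for the product count that follows. *)
Lemma card_compositions m b : (m <= b)%N ->
  #|[pred g : {ffun 'I_k.+1 -> 'I_b.+1} | \sum_j g j == m]%N| = 'C(k + m, k).
Proof.
move=> mb; rewrite -card_ord_partitions.
pose f (t : k.+1.-tuple 'I_m.+1) : {ffun 'I_k.+1 -> 'I_b.+1} :=
  [ffun j => widen_ord (mb : (m < b.+1)%N) (tnth t j)].
have fi : injective f.
  move=> t u /ffunP tu; apply: eq_from_tnth => j; have /(congr1 val) := tu j.
  by rewrite !ffunE /= => ?; apply: val_inj.
rewrite -(card_imset _ fi); apply: eq_card => g; rewrite !inE.
apply/eqP/imsetP => [gm|[t]].
  have gle j : (g j < m.+1)%N by rewrite ltnS -gm (bigD1 j)//= leq_addr.
  exists [tuple Ordinal (gle j) | j < k.+1].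
    by rewrite inE big_tuple; apply/eqP; rewrite -[RHS]gm; apply: eq_bigr => j _; rewrite tnth_mktuple.
  by apply/ffunP => j; apply: val_inj; rewrite !ffunE /= tnth_mktuple.
rewrite inE big_tuple => /eqP tm ->; rewrite -[RHS]tm.
by apply: eq_bigr => j _; rewrite ffunE.
Qed.

(** The colors are independent, so the count is a product of numbers of compositions. *)
Lemma ncard_color_degree n : ncard [set x | color_degree x =1 n] = (\prod_i 'C(k + n i, k))%N.
Proof.
pose b := (\max_i n i)%N.
pose F i := [pred g : {ffun 'I_k.+1 -> 'I_b.+1} | \sum_j g j == n i]%N.
pose f (g : {ffun 'I_r -> {ffun 'I_k.+1 -> 'I_b.+1}}) : expo :=
  [ffun t => g t.1 t.2 : nat].
have -> : [set x | color_degree x =1 n] = f @` [set g | g \in family F].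
  apply/seteqP; split => x /=.
    move=> xn; have xb i j : (x (i, j) < b.+1)%N.
      by rewrite ltnS (leq_trans (leq_color_degree x i j))// xn; exact: (leq_bigmax i).
    exists [ffun i => [ffun j => Ordinal (xb i j)]].
      apply/familyP => i; rewrite inE -xn; apply/eqP/eq_bigr => j _.
      by rewrite !ffunE.
    by apply/ffunP => -[i j]; rewrite !ffunE.
  move=> [g /familyP gF <-] i; have := gF i; rewrite inE => /eqP <-.
  by apply: eq_bigr => j _; rewrite ffunE.
rewrite ncard_inj//; last first.
  move=> g h _ _ /ffunP gh; apply/ffunP => i; apply/ffunP => j.
  by have := gh (i, j); rewrite !ffunE /= => ?; apply: val_inj.
rewrite (ncard_fin (fun g => g \in family F)).
have -> : #|fun g => g \in family F| = #|family F| by exact: eq_card.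
rewrite card_family.
rewrite [LHS](_ : _ = \prod_i #|F i|)%N; last first.
  by rewrite foldrE big_image.
apply: eq_bigr => i _; apply: card_compositions.
exact: (leq_bigmax i).
Qed.

(** The exponents above p in the complement of the ideal of exponents generated by L. *)
Definition avoid (L : seq expo) p n : set expo :=
  [set x | [/\ expo_le p x, color_degree x =1 n & forall l, l \in L -> ~ expo_le l x]].

Lemma finite_avoid L p n : finite_set (avoid L p n).
Proof. by apply: sub_finite_set (finite_color_degree n) => x []. Qed.

(** Inclusion-exclusion, one generator l at a time: among the exponents above p that
    avoid L, those that are not above l remain, and those above l are the exponents
    above the supremum of p and l that avoid L. *)
Lemma eventually_poly_avoid L p : eventually_poly R (fun n => ncard (avoid L p n)).
Proof.
elim: L p => [|l L IHL] p.
  have [P HP] := poly_prod_bin R k (color_degree p).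
  exists (\max_i color_degree p i)%N, P => n qn.
  have pn i : (color_degree p i <= n i)%N by exact: leq_trans (leq_bigmax i) (qn i).
  rewrite -HP//; congr (_ %:R); rewrite -ncard_color_degree.
  have -> : avoid [::] p n = (expo_add^~ p) @` [set x | color_degree x =1 fun i => (n i - color_degree p i)%N].
    apply/seteqP; split => x /=.
      case=> px xn _; exists (expo_sub x p); last exact: expo_subK.
      by move=> i; rewrite -xn -{2}(expo_subK px) color_degreeD addnK.
    move=> [y yn <-]; split=> // [t|i]; first by rewrite ffunE leq_addl.
    by rewrite color_degreeD yn subnK.
  rewrite ncard_inj//; first exact: finite_color_degree.
  move=> x y _ _ /ffunP xy; apply/ffunP => t; have := xy t.
  by rewrite !ffunE => /addIn.
apply: eventually_polyB (IHL p) (IHL (expo_sup p l)) => n.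
rewrite addnC (ncardID [set x | expo_le l x] (finite_avoid L p n)) addnC.
congr (_ + _)%N; congr ncard; apply/seteqP; split => x /=.
- move=> [[px xn Lx] nlx]; split=> // u; rewrite inE => /orP[/eqP->//|/Lx//].
- move=> [px xn Lx]; split; last by apply: Lx; rewrite inE eqxx.
  by split=> // u uL; apply: Lx; rewrite inE uL orbT.
- move=> [[px xn Lx] lx]; split=> // t.
  by rewrite ffunE geq_max px lx.
- move=> [sx xn Lx]; split; last by move=> t; have := sx t; rewrite ffunE geq_max => /andP[].
  by split=> // t; have := sx t; rewrite ffunE geq_max => /andP[].
Qed.

(** Exponents are ordered through monomials, whose order is a well-order compatible
    with addition. *)
Definition monomial_code x := Multinom [tuple x (enum_val i) | i < #|{: T}|].

Lemma monomial_codeD x y : monomial_code (expo_add x y) = mnm_add (monomial_code x) (monomial_code y).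
Proof. by apply/mnmP => i; rewrite mnmDE !mnmE ffunE. Qed.

Lemma monomial_code_inj : injective monomial_code.
Proof.
move=> x y /mnmP xy; apply/ffunP => t; have := xy (enum_rank t).
by rewrite !mnmE enum_rankK.
Qed.

(** Exponents that are not the least one among those with the same number of summands
    of each color and the same sum. *)
Definition nonminimal : set expo :=
  [set x | exists y, [/\ color_degree y =1 color_degree x, weighted_sum y = weighted_sum x & (monomial_code y < monomial_code x)%O]].

(** Adding the same exponent to x and to a smaller exponent with the same sum preserves
    the comparison: the nonminimal exponents form an ideal. *)
Lemma nonminimal_upset l x : expo_le l x -> nonminimal l -> nonminimal x.
Proof.
move=> lx [y [yl wl ltyl]]; exists (expo_add (expo_sub x l) y); split=> [i||].
- by rewrite -{2}(expo_subK lx) !color_degreeD yl.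
- by rewrite -{2}(expo_subK lx) !weighted_sumD wl.
- by rewrite -{2}(expo_subK lx) !monomial_codeD ltmc_add2r.
Qed.

Lemma minimal_representative x : exists y, [/\ color_degree y =1 color_degree x, weighted_sum y = weighted_sum x & ~ nonminimal y].
Proof.
have [m] : exists m, m = monomial_code x by exists (monomial_code x).
elim/(@ltmwf #|{: T}|): m x => m IH x mx.
have [[y [yx wyx ltyx]]|nx] := pselect (nonminimal x); last by exists x.
have [|z [zy wzy nz]] := IH (monomial_code y) _ y erefl; first by rewrite mx.
by exists z; split=> // [i|]; rewrite ?zy// wzy.
Qed.

(** Every element of the sumset has exactly one minimal representative. The others form
    an ideal of exponents, finitely generated by Dickson's lemma, so the minimal ones
    are counted by inclusion-exclusion. *)
Theorem eventually_poly_weighted_sums : eventually_poly R (fun n => ncard (weighted_sums n)).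
Proof.
have [L [LP Lb]] := dickson (fun x t => x t) (enum {: T}) nonminimal.
have [q [P HP]] := eventually_poly_avoid L [ffun=> 0%N].
have nonminimalE x : nonminimal x <-> exists2 l, l \in L & expo_le l x.
  split=> [/Lb[l lL lx]|[l /LP ln lx]]; last exact: nonminimal_upset ln.
  by exists l => // t; apply: lx; rewrite mem_enum.
exists q, P => n qn; rewrite -HP//; congr (_ %:R).
have -> : weighted_sums n = weighted_sum @` avoid L [ffun=> 0%N] n.
  apply/seteqP; split => g /= [x].
    move=> xn <-; have [y [yx wyx ny]] := minimal_representative x.
    exists y => //; split=> [t|i|l lL lx]; first by rewrite ffunE.
      by rewrite yx xn.
    by apply: ny; apply/nonminimalE; exists l.
  by move=> [_ xn _] <-; exists x.
rewrite ncard_inj//; first exact: finite_avoid.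
move=> x y /set_mem[_ xn Lx] /set_mem[_ yn Ly] wxy.
have nx : ~ nonminimal x by move=> /nonminimalE[l /Lx].
have ny : ~ nonminimal y by move=> /nonminimalE[l /Ly].
case: (ltgtP (monomial_code x) (monomial_code y)) => [lt|lt|/monomial_code_inj//].
- by case: ny; exists x; split=> // i; rewrite xn yn.
- by case: nx; exists y; split=> // i; rewrite xn yn.
Qed.

Lemma finite_weighted_sums n : finite_set (weighted_sums n).
Proof. by apply: finite_image; exact: finite_color_degree. Qed.

End Sumsets.

(** * Polarization of homogeneous polynomials *)

Section Polarization.
Context {R : comNzRingType}.
Implicit Types (e r : nat).

(** For V S the value of a homogeneous form at the sum of the vectors indexed by S, this
    is the value of e! times its polar form at these vectors. *)
Definition polar {e} (V : {set 'I_e} -> R) : R :=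
  \sum_(S : {set 'I_e}) (-1) ^+ #|~: S| * V S.

Definition blockcount {e r} (S : {set 'I_e}) (f : 'I_e -> 'I_r) (i : 'I_r) : nat :=
  #|[set j in S | f j == i]|.

(** The alternating sum over the sets S that contain the image of f vanishes unless
    the image is everything. *)
Lemma polar_image e (f : {ffun 'I_e -> 'I_e}) :
  polar (fun S => \prod_j (f j \in S)%:R) = (injectiveb f)%:R.
Proof.
transitivity (\prod_(i < e) (1 + - (i \notin codom f)%:R : R)).
  rewrite (@bigA_distr _ _ _ _ +%R _ (fun=> 1)); apply: eq_bigr => S _.
  rewrite [RHS](bigID [in S])/= [X in _ = X * _]big1 ?mul1r; last by move=> i ->.
  rewrite [RHS](eq_bigr (fun i => -1 * (i \notin codom f)%:R)); last first.
    by move=> i /negbTE->; rewrite mulN1r.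
  rewrite big_split/=.
  rewrite [X in _ = X * _](eq_bigl (fun i => i \in ~: S)); last by move=> i; rewrite inE.
  rewrite prodr_const; congr (_ * _).
  have [fS|nfS] := boolP [forall j, f j \in S].
    rewrite big1 => [|j _]; last by rewrite (forallP fS).
    rewrite big1// => i iS; rewrite (_ : i \notin codom f)//.
    by apply: contra iS => /codomP[j ->]; exact: (forallP fS).
  move: nfS; rewrite negb_forall => /existsP[j jS].
  rewrite (bigD1 j)//= (negbTE jS) mul0r; apply/esym.
  by rewrite (bigD1 (f j))//= codom_f mul0r.
have [/injectiveP fi|nfi] := boolP (injectiveb f).
  rewrite big1// => i _.
  by rewrite (_ : i \in codom f) ?subr0//; apply/codomP; have [g _ gf] := injF_bij fi; exists (g i).
have [i ni] : exists i, i \notin codom f.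
  apply/existsP; rewrite -negb_forall; apply: contra nfi => /forallP fs.
  apply/injectiveP; apply/injectiveP; rewrite /dinjectiveb -/(codom f).
  rewrite /injectiveb /dinjectiveb; apply/card_uniqP.
  rewrite size_map -cardE; apply: eq_card => i; have := fs i.
  by rewrite !inE.
by rewrite (bigD1 i)//= ni subrr mul0r.
Qed.

(** Expanding the powers turns the left-hand side into a sum over all maps f of [e] to
    itself; by polar_image only the permutations survive, and each of them forces
    phi = psi o f^-1. *)
(** A homogeneous form is determined by its values at vectors of nonnegative integers,
    through finitely many of them. Being linear in these values, the identity survives
    pointwise limits. *)
Lemma polarization_monomial e r (psi : {ffun 'I_e -> 'I_r}) (l : 'I_r -> R) :
  \sum_(phi : {ffun 'I_e -> 'I_r}) (\prod_j l (phi j)) *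
     polar (fun S => \prod_j (blockcount S phi (psi j))%:R) =
  e`!%:R * \prod_j l (psi j).
Proof.
have cntE phi S : \prod_j (blockcount S phi (psi j))%:R =
    \sum_(f : {ffun 'I_e -> 'I_e}) \prod_j (f j \in S)%:R *
      (\prod_j (phi (f j) == psi j)%:R) :> R.
  rewrite (eq_bigr (fun j => \sum_i (i \in S)%:R * (phi i == psi j)%:R)).
    by rewrite bigA_distr_bigA; apply: eq_bigr => f _; rewrite big_split.
  move=> j _; rewrite /blockcount -sum1_card natr_sum big_mkcond/=.
  by apply: eq_bigr => i _; rewrite inE; case: (i \in S); case: eqP; rewrite ?mulr1 ?mulr0 ?mul0r.
transitivity (\sum_(phi : {ffun 'I_e -> 'I_r}) \sum_(f : {ffun 'I_e -> 'I_e})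
   (\prod_j l (phi j)) * ((injectiveb f)%:R * \prod_j (phi (f j) == psi j)%:R)).
  apply: eq_bigr => phi _; rewrite -mulr_sumr; congr (_ * _).
  transitivity (\sum_(f : {ffun 'I_e -> 'I_e}) polar (fun S => \prod_j (f j \in S)%:R) *
     (\prod_j (phi (f j) == psi j)%:R : R)); last first.
    by apply: eq_bigr => f _; rewrite polar_image.
  rewrite {1}/polar (eq_bigr (fun S : {set 'I_e} => \sum_(f : {ffun 'I_e -> 'I_e}) (-1) ^+ #|~: S| *
     (\prod_j (f j \in S)%:R * (\prod_j (phi (f j) == psi j)%:R)))); last first.
    by move=> S _; rewrite cntE mulr_sumr.
  rewrite exchange_big; apply: eq_bigr => f _.
  by rewrite mulr_suml; apply: eq_bigr => S _; rewrite mulrA.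
have efact : e`! = (\sum_(f : {ffun 'I_e -> 'I_e} | injectiveb f) 1)%N.
  rewrite -ffactnn -[in LHS](card_ord e) -card_inj_ffuns -sum1_card.
  by apply: eq_bigl => f; rewrite inE.
rewrite exchange_big/= efact natr_sum mulr_suml [RHS]big_mkcond/=.
apply: eq_bigr => f _.
case: injectiveP => fi; last by rewrite big1// => phi _; rewrite mul0r mulr0.
rewrite mul1r; have [g fg gf] := injF_bij fi.
rewrite (bigD1 [ffun j => psi (g j)])//= [X in _ + X]big1 ?addr0.
  rewrite mul1r [X in _ * X]big1 ?mulr1 => [|j _]; last by rewrite ffunE fg eqxx.
  rewrite (reindex_inj fi); apply: eq_bigr => j _.
  by rewrite ffunE fg.
move=> phi /eqP nphi; rewrite mul1r.
have [/forallP phif|] := boolP [forall j, phi (f j) == psi j].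
  case: nphi; apply/ffunP => j; rewrite ffunE -(eqP (phif (g j))).
  by rewrite gf.
rewrite negb_forall => /existsP[j /negbTE jn].
by rewrite [X in _ * X](bigD1 j)//= jn mul0r mulr0.
Qed.
End Polarization.

Section Contents.
Variable r : nat.

(** The exponent of the monomial obtained by multiplying the variables listed by f. *)
Definition content {d} (f : 'I_d -> 'I_r) : multinom r :=
  Multinom [tuple blockcount [set: 'I_d] f i | i < r].

Lemma contentE d (f : 'I_d -> 'I_r) i : content f i = blockcount [set: 'I_d] f i.
Proof. by rewrite mnmE. Qed.

Lemma prod_content (R : comNzRingType) d (f : 'I_d -> 'I_r) (l : 'I_r -> R) :
  \prod_j l (f j) = \prod_i l i ^+ content f i.
Proof.
rewrite (partition_big f xpredT)//=; apply: eq_bigr => i _.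
rewrite (eq_bigr (fun=> l i)) => [|j /eqP->//].
by rewrite prodr_const contentE /blockcount; congr (_ ^+ _); apply: eq_card => j; rewrite !inE.
Qed.

Lemma mdeg_content d (f : 'I_d -> 'I_r) : mdeg (content f) = d.
Proof.
rewrite mdegE -[RHS](card_ord d) -sum1_card [RHS](partition_big f xpredT)//=.
apply: eq_bigr => i _; rewrite contentE /blockcount -sum1_card.
by apply: eq_bigl => j; rewrite !inE.
Qed.

(** The list of the indices i, each repeated a i times, cut into a function on 'I_d; the
    second clause is in the form in which such a list is used for bodies. *)
Lemma listing d (a : multinom r) : mdeg a = d ->
  exists2 f : {ffun 'I_d -> 'I_r}, content f = a &
    forall (T : Type) (x0 : T) (F : 'I_r -> T) (j : 'I_d),
      nth x0 (flatten [seq nseq (a i) (F i) | i <- enum 'I_r]) j = F (f j).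
Proof.
move=> ad; pose s := flatten [seq nseq (a i) i | i <- enum 'I_r].
have sE (T : Type) (F : 'I_r -> T) :
    flatten [seq nseq (a i) (F i) | i <- enum 'I_r] = [seq F i | i <- s].
  rewrite /s map_flatten -map_comp; congr flatten.
  by apply: eq_map => i /=; rewrite map_nseq.
have ss : size s == d.
  rewrite size_flatten /shape -map_comp sumnE. rewrite big_map. rewrite big_enum/= -ad mdegE.
  by apply/eqP/eq_bigr => i _; rewrite size_nseq.
exists [ffun j => tnth (Tuple ss) j].
  apply/mnmP => i; rewrite contentE /blockcount.
  have -> : a i = count_mem i s.
    rewrite /s count_flatten sumnE 2!big_map big_enum/=.
    rewrite (bigD1 i)//= count_nseq /= eqxx mul1n big1 ?addn0// => j ji.
    by rewrite count_nseq /= (negbTE ji).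
  transitivity (count_mem i [seq tnth (Tuple ss) j | j <- enum 'I_d]); last first.
    by rewrite map_tnth_enum.
  rewrite count_map -size_filter cardE /enum_mem; congr size.
  rewrite -filter_predI -?enumT; apply: eq_filter => j /=.
  by rewrite !inE ffunE andbT andTb.
move=> T x0 F j.
have js : (j < size s)%N by rewrite (eqP ss).
rewrite sE (nth_map (tnth (Tuple ss) j) x0 F js) ffunE; congr F.
by rewrite [RHS](tnth_nth (tnth (Tuple ss) j)).
Qed.

(** The multinomial formula, read off the derivative of (X_1 + .. + X_r)^(d+1): its
    partial derivatives are all (d+1) (X_1 + .. + X_r)^d. *)
Lemma mcoeff_sumX_exp d (a : multinom r) : mdeg a = d ->
  mcoeff a ((\sum_i mpolyX int (mnm1 i)) ^+ d) * (mnm_fact a)%:Z = d`!%:Z.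
Proof.
elim: d a => [|d IHd] a ad.
  have -> : a = mnm0 by apply/eqP; rewrite -mdeg_eq0 ad.
  rewrite expr0 mcoeff1 eqxx mul1r /mnm_fact big1// => i _.
  by rewrite mnm0E.
have [i ai] : exists i, (0 < a i)%N.
  apply/existsP; apply: contra_eqT ad; rewrite negb_exists => /forallP a0.
  by rewrite mdegE big1// => i _; apply/eqP; have := a0 i; rewrite -eqn0Ngt.
pose b := mnm_sub a (mnm1 i).
have ab : a = mnm_add b (mnm1 i).
  rewrite /b submK//; apply/mnm_lepP => j; rewrite mnm1E.
  by case: eqP => // <-.
have bd : mdeg b = d by move: ad; rewrite ab mdegD mdeg1 addn1 => -[].
have bi : a i = (b i).+1 by rewrite {1}ab mnmDE mnm1E eqxx addn1.
have fab : mnm_fact a = (a i * mnm_fact b)%N.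
  rewrite /mnm_fact (bigD1 i)//= [in RHS](bigD1 i)//= mulnA; congr (_ * _)%N.
    by rewrite bi factS.
  by apply: eq_bigr => j ji; rewrite ab mnmDE mnm1E eq_sym (negbTE ji) addn0.
set s := \sum_i _.
have ds : mderiv i s = 1.
  rewrite /s raddf_sum/= (bigD1 i)//= mderivX mnm1E eqxx scale1r.
  rewrite big1 ?addr0 => [|j ji]; last by rewrite mderivX mnm1E (negbTE ji) scale0r.
  by rewrite (_ : mnm_sub _ _ = mnm0) ?mpolyX0//; apply/mnmP => j; rewrite mnmBE subnn mnm0E.
have dsn n : mderiv i (s ^+ n.+1) = s ^+ n *+ n.+1.
  elim: n => [|n IHn]; first by rewrite expr1 expr0 ds.
  by rewrite exprS mderivM ds mul1r IHn mulrnAr -exprS -mulrS.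
have := mcoeff_deriv i b (s ^+ d.+1); rewrite dsn -ab -bi mcoeffMn => sab.
rewrite fab PoszM mulrA -(natz (a i)) mulr_natr -sab mulrnAl IHd//.
by rewrite factS PoszM -mulr_natl natz.
Qed.

(** Both sides compute a coefficient of (X_1 + .. + X_r)^d, expanded over all maps f. *)
Lemma card_content d (a : multinom r) : mdeg a = d ->
  (#|[pred f : {ffun 'I_d -> 'I_r} | content f == a]| * mnm_fact a = d`!)%N.
Proof.
move=> ad; apply/eqP; rewrite -eqz_nat PoszM -(mcoeff_sumX_exp ad); apply/eqP.
congr (_ * _); rewrite -[d in _ ^+ d]card_ord -prodr_const bigA_distr_bigA raddf_sum/=.
rewrite -sum1_card -natz natr_sum big_mkcond/=; apply: eq_bigr => f _.
rewrite mprodXE mcoeffX inE; set m := \big[_/_]_(_ < _) _.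
rewrite (_ : m = content f); first by case: eqP.
apply/mnmP => i; rewrite contentE /m mnm_sumE /blockcount -sum1_card.
rewrite [RHS]big_mkcond/=; apply: eq_bigr => j _.
by rewrite mnm1E !inE andTb; case: eqP.
Qed.

(** Passage from a sum over all maps, natural for multilinear expressions, to the sum
    over exponents with the weights 1 / a! of the mixed volume formula. *)
Lemma sum_content (R : realFieldType) d (g : multinom r -> R) :
  \sum_(f : {ffun 'I_d -> 'I_r}) g (content f) =
  d`!%:R * \sum_(a : bmultinom r d.+1 | mdeg a == d) (mnm_fact a)%:R^-1 * g a.
Proof.
have cb (f : {ffun 'I_d -> 'I_r}) : (mdeg (content f) < d.+1)%N by rewrite mdeg_content.
rewrite (partition_big (fun f => BMultinom (cb f)) (fun a : bmultinom r d.+1 => mdeg a == d))/=.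
  rewrite mulr_sumr; apply: eq_bigr => a /eqP ad.
  rewrite (eq_bigr (fun=> g a)) => [|f /eqP <-//].
  have nz : (mnm_fact a)%:R != 0 :> R.
    by rewrite pnatr_eq0 -lt0n prodn_gt0// => i; exact: fact_gt0.
  have /(congr1 (fun n => n%:R : R)) := card_content ad; rewrite natrM => <-.
  rewrite mulrA mulfK// mulr_natl sumr_const; congr (_ *+ _).
by move=> f _; rewrite mdeg_content.
Qed.

End Contents.

Section HomogeneousComponents.
Context {R : realType} {r : nat}.

(** The value at l of the degree e homogeneous component of P. *)
Definition hom_part e (P : mpoly r R) (l : 'I_r -> R) : R :=
  \sum_(a <- msupp P | mdeg a == e) mcoeff a P * \prod_i l i ^+ a i.

Lemma polarization e P l :
  \sum_(phi : {ffun 'I_e -> 'I_r}) (\prod_j l (phi j)) *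
     polar (fun S => hom_part e P (fun i => (blockcount S phi i)%:R)) =
  e`!%:R * hom_part e P l.
Proof.
rewrite /hom_part mulr_sumr.
transitivity (\sum_(phi : {ffun 'I_e -> 'I_r}) \sum_(a <- msupp P | mdeg a == e)
   mcoeff a P * ((\prod_j l (phi j)) *
     polar (fun S => \prod_i (blockcount S phi i)%:R ^+ a i))).
  apply: eq_bigr => phi _; rewrite /polar.
  rewrite (eq_bigr (fun S : {set 'I_e} => \sum_(a <- msupp P | mdeg a == e)
    mcoeff a P * ((-1) ^+ #|~: S| * \prod_i (blockcount S phi i)%:R ^+ a i))).
    rewrite exchange_big/= mulr_sumr; apply: eq_bigr => a _.
    by rewrite mulrCA -!mulr_sumr.
  by move=> S _; rewrite mulr_sumr; apply: eq_bigr => a _; rewrite mulrCA.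
rewrite exchange_big/=; apply: eq_bigr => a /eqP ad.
rewrite -mulr_sumr mulrCA; congr (_ * _).
have [psi psia _] := listing ad.
rewrite -psia -prod_content -polarization_monomial; apply: eq_bigr => phi _.
congr (_ * _); rewrite /polar; apply: eq_bigr => S _; congr (_ * _).
by rewrite (prod_content psi (fun i => (blockcount S phi i)%:R)).
Qed.

Lemma meval_hom_part P l D : (forall a, a \in msupp P -> (mdeg a <= D)%N) ->
  meval l P = \sum_(e < D.+1) hom_part e P l.
Proof.
move=> PD; rewrite mevalE big_seq_cond.
rewrite (partition_big (fun a => inord (mdeg a) : 'I_D.+1) xpredT)//=.
apply: eq_bigr => e _; rewrite /hom_part big_mkcond [RHS]big_mkcond/=.
rewrite big_seq [RHS]big_seq; apply: eq_bigr => a aP.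
by rewrite aP -val_eqE/= inordK// ltnS PD.
Qed.

Lemma hom_partZ e P l (t : R) : hom_part e P (fun i => t * l i) = t ^+ e * hom_part e P l.
Proof.
rewrite /hom_part mulr_sumr; apply: eq_bigr => a /eqP ae.
rewrite mulrCA; congr (_ * _).
rewrite (eq_bigr (fun i => t ^+ a i * l i ^+ a i)) => [|i _]; last by rewrite exprMn.
by rewrite big_split/= prodrXr -ae mdegE.
Qed.

End HomogeneousComponents.

(** * Volume and lattice points *)

Section Lattice.
Context {R : realType} {d : nat}.
Implicit Types (K : set 'rV[R]_d) (x y : 'rV[R]_d) (p : 'rV[int]_d) (t : R).

Definition floor_vec x : 'rV[int]_d := \row_j Num.floor (x 0 j).
Definition int_vec p : 'rV[R]_d := \row_j (p 0 j)%:~R.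
(** The integer points whose unit cubes meet the dilate of K by t. *)
Definition floors t K : set 'rV[int]_d := [set floor_vec (t *: x) | x in K].
Definition bounded_by (B : R) K := forall x, K x -> forall j, `|x 0 j| <= B.
(** The integer points of the dilate by t of the e-neighbourhood of K for the sup norm. *)
Definition thick t e K : set 'rV[int]_d :=
  [set p | exists2 x, K x & forall j, `|(p 0 j)%:~R - t * x 0 j| <= t * e].

Lemma int_box (c : 'rV[int]_d) (n : 'I_d -> nat) :
  let A := [set p : 'rV[int]_d | forall j, c 0 j <= p 0 j <= c 0 j + (n j)%:Z] in
  finite_set A /\ (ncard A <= \prod_j (n j).+1)%N.
Proof.
move=> A; pose b := (\max_j n j)%N.
pose F j := [pred z : 'I_b.+1 | (z <= n j)%N].
pose f (g : {ffun 'I_d -> 'I_b.+1}) : 'rV[int]_d := c + \row_j (g j : nat)%:Z.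
have AF : A `<=` f @` [set g | g \in family F].
  move=> p pA; have pj j : exists m : nat, p 0 j = c 0 j + m%:Z /\ (m <= n j)%N.
    by have := pA j => /andP[h1 h2]; exists `|(p 0 j - c 0 j)%R|%N; split; lia.
  have /choice[m mP] := pj.
  have mb j : (m j < b.+1)%N.
    by have [_ mn] := mP j; rewrite ltnS (leq_trans mn)//; exact: (leq_bigmax j).
  exists [ffun j => Ordinal (mb j)].
    by apply/familyP => j; rewrite ffunE inE/=; have [] := mP j.
  apply/rowP => j; rewrite !mxE ffunE/=; by have [] := mP j.
have fF : finite_set [set g | g \in family F] by exact: finite_finset.
have ffF := finite_image f fF.
split; first exact: sub_finite_set AF ffF.
apply: leq_trans (ncard_le ffF AF) _; apply: leq_trans (ncard_image_le _ fF) _.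
rewrite (ncard_fin (fun g => g \in family F)).
have -> : #|fun g => g \in family F| = #|family F| by exact: eq_card.
rewrite card_family foldrE big_image; apply: leq_prod => j _ /=.
rewrite -[leqRHS]card_ord.
apply: (@leq_card_in _ _ (fun z : 'I_b.+1 => inord z : 'I_(n j).+1)) => z z'.
move=> zn zn'; have {}zn : (z <= n j)%N by exact: zn.
have {}zn' : (z' <= n j)%N by exact: zn'.
by move=> /(congr1 val); rewrite /= !inordK// => /val_inj.
Qed.

Lemma real_box (a b : 'I_d -> R) : (forall j, a j <= b j) ->
  let A := [set p : 'rV[int]_d | forall j, a j <= (p 0 j)%:~R <= b j] in
  finite_set A /\ (ncard A)%:R <= \prod_j (b j - a j + 1).
Proof.
move=> ab A.
pose c : 'rV[int]_d := \row_j Num.ceil (a j).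
have fl j : exists n : nat, n%:Z = Num.floor (b j - a j).
  exists `|(Num.floor (b j - a j))%R|%N; rewrite gez0_abs// floor_ge0 subr_ge0; exact: ab.
have /choice[n nP] := fl.
have [fB cB] := int_box c n.
have AB : A `<=` [set p | forall j, c 0 j <= p 0 j <= c 0 j + (n j)%:Z].
  move=> p pA j; have /andP[ap pb] := pA j; rewrite mxE; apply/andP; split.
    by rewrite ceil_le_int.
  rewrite -lerBlDl nP floor_ge_int intrB lerB//.
  by rewrite ceil_ge.
split; first exact: sub_finite_set AB fB.
apply: (@le_trans _ _ (\prod_j (n j).+1)%N%:R).
  by rewrite ler_nat (leq_trans _ cB)// ncard_le.
rewrite natr_prod; apply: ler_prod => j _; rewrite ler0n/= -natr1 lerD2r.
have := floor_le (b j - a j); rewrite -nP.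
by [].
Qed.

Lemma finite_floors B t K : bounded_by B K -> finite_set (floors t K).
Proof.
move=> KB; have [|fA _] := @real_box (fun=> - (`|t| * `|B| + 1)) (fun=> `|t| * `|B| + 1).
  by move=> j; rewrite -subr_ge0 opprK; have := mulr_ge0 (normr_ge0 t) (normr_ge0 B); lra.
apply: sub_finite_set fA => p [x Kx <-] j; rewrite mxE mxE.
have xB : `|t * x 0 j| <= `|t| * `|B|.
  by rewrite normrM ler_wpM2l// (le_trans (KB x Kx j))// ler_norm.
move: xB; rewrite ler_norml => /andP[x1 x2].
have /andP[y1 y2] := floor_itv (t * x 0 j); rewrite intrD in y2.
by apply/andP; split; lra.
Qed.

Lemma finite_thick B t e K : bounded_by B K -> finite_set (thick t e K).
Proof.
move=> KB; pose C := `|t| * `|B| + `|t * e|.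
have [|fA _] := @real_box (fun=> - C) (fun=> C).
  move=> j; rewrite -subr_ge0 opprK /C.
  by have := mulr_ge0 (normr_ge0 t) (normr_ge0 B); have := normr_ge0 (t * e); lra.
apply: sub_finite_set fA => p [x Kx px] j; have := px j; have := KB x Kx j.
move=> xB; rewrite -ler_norml /C => pxj.
have xB' : `|t * x 0 j| <= `|t| * `|B|.
  by rewrite normrM ler_wpM2l// (le_trans xB)// ler_norm.
rewrite -(subrK (t * x 0 j) (_%:~R)) (le_trans (ler_normD _ _))// addrC lerD//.
by rewrite (le_trans pxj)// ler_norm.
Qed.

Lemma lebesgue_outer_ge0 K : (0 <= lebesgue_outer K)%E.
Proof.
apply: le_ereal_inf_tmp => _ [a [b [ab _ ->]]]; apply: nneseries_ge0 => n _ _.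
by rewrite lee_fin prodr_ge0// => j _; rewrite subr_ge0.
Qed.

(** The unit cubes at the points of floors t K cover t K; scaled by 1 / t they cover K.
    As covers are indexed by all natural numbers, the list of cubes is completed by
    points, which have measure 0 because d > 0. *)
Lemma lebesgue_outer_floors B t K : (0 < d)%N -> bounded_by B K -> 0 < t ->
  (lebesgue_outer K <= ((ncard (floors t K))%:R / t ^+ d)%:E)%E.
Proof.
move=> d0 KB t0; pose s := enum_fset (fset_set (floors t K)).
have fK := finite_floors t KB.
apply: ereal_inf_lbound.
exists (fun n => if (n < size s)%N then t^-1 *: int_vec (nth 0 s n) else 0).
exists (fun n => if (n < size s)%N then t^-1 *: (int_vec (nth 0 s n) + const_mx 1) else 0).
split=> [n j|x Kx|].
- case: ifP => // _; rewrite !mxE ler_wpM2l ?lerDl//.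
  by rewrite invr_ge0 ltW.
- have : floor_vec (t *: x) \in s by rewrite in_fset_set//; apply/mem_set; exists x.
  move=> /(nthP 0)[n ns np]; exists n => // j.
  rewrite /= ns np !mxE ler_pdivrMl// ler_pdivlMl//.
  have /andP[h1 /ltW] := floor_itv (t * x 0 j); rewrite intrD => h2.
  by rewrite h1 h2.
- rewrite (@nneseries_split _ _ 0 (size s)); last first.
    move=> k _; case: ifP => _; rewrite lee_fin prodr_ge0// => j _; rewrite ?subrr// !mxE.
    by rewrite subr_ge0 ler_wpM2l ?lerDl// invr_ge0 ltW.
  rewrite add0n [X in (_ + X)%E]eseries0 ?adde0; last first.
    move=> k sk _; rewrite ltnNge sk/= (bigD1 (Ordinal d0))//= subrr mul0r.
    by [].
  rewrite big_nat (eq_bigr (fun=> (t ^- d)%:E)); last first.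
    move=> n /andP[_ ns]; rewrite ns; congr (_%:E).
    rewrite (eq_bigr (fun=> t^-1)) => [|j _]; last by rewrite !mxE mulrDr mulr1 addrAC subrr add0r.
    by rewrite prodr_const card_ord exprVn.
  rewrite -big_nat big_mkord sumEFin sumr_const card_ord; congr (_%:E).
  by rewrite -[RHS]mulr_natl.
Qed.

Lemma Vol_fin B K : (0 < d)%N -> bounded_by B K -> lebesgue_outer K = (Vol K)%:E.
Proof.
move=> d0 KB; rewrite /Vol fineK// ge0_fin_numE ?lebesgue_outer_ge0//.
by rewrite (le_lt_trans (lebesgue_outer_floors d0 KB ltr01))// ltry.
Qed.

Lemma Vol_le_floors B t K : (0 < d)%N -> bounded_by B K -> 0 < t ->
  t ^+ d * Vol K <= (ncard (floors t K))%:R.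
Proof.
move=> d0 KB t0; have := lebesgue_outer_floors d0 KB t0.
by rewrite (Vol_fin d0 KB) lee_fin ler_pdivlMr ?exprn_gt0// mulrC.
Qed.

Lemma open_box (a b : 'I_d -> R) : open [set x : 'rV[R]_d | forall j, a j < x 0 j < b j].
Proof.
rewrite openE => x xab; exists (fun _ j => [set y | a j < y < b j]) => [i j|y yP j].
  have -> : [set y | a j < y < b j] = `]a j, b j[%classic.
    by apply/seteqP; split=> y; rewrite /= in_itv.
  apply: open_nbhs_nbhs; split; first exact: itv_open.
  by rewrite (ord1 i)/= in_itv; exact: xab.
exact: yP.
Qed.

(** Finitely many of the open cubes (-n, n)^d cover the set. *)
Lemma compact_bounded_by K : compact K -> exists2 B, 0 < B & bounded_by B K.
Proof.
rewrite compact_cover => cK.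
pose U (n : nat) : set 'rV[R]_d := [set x | forall j, - n%:R < x 0 j < n%:R].
have [] := cK nat setT U.
- by move=> n _; exact: open_box.
- move=> x _; pose f j := (Num.truncn `|x 0 j|).+1; exists (\max_j f j)%N => // j.
  rewrite -ltr_norml (lt_le_trans (truncnS_gt _))// ler_nat -/(f j).
  exact: (leq_bigmax j).
move=> D _ KD; exists (\max_(n <- D) n)%N.+1%:R => [|x Kx j]; first by rewrite ltr0n.
have [n nD xn] := KD x Kx.
have := xn j; rewrite -ltr_norml => /ltW h; apply: (le_trans h).
by rewrite ler_nat leqW// (big_rem n)//= leq_max leqnn.
Qed.

(** Continuity of the volume of a box in its side lengths; the factor 5 is the total
    widening that occurs in thick_le_Vol. *)
Lemma prod_widen (w : 'I_d -> R) (e : R) : 0 < e ->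
  exists2 h, 0 < h & \prod_j (w j + 5 * h) <= \prod_j w j + e.
Proof.
move=> e0; pose p : {poly R} := \prod_j ((w j)%:P + 5%:P * 'X).
have pE h : p.[h] = \prod_j (w j + 5 * h).
  by rewrite horner_prod; apply: eq_bigr => j _; rewrite !hornerE.
have p0 : p.[0] = \prod_j w j.
  by rewrite pE; apply: eq_bigr => j _; rewrite mulr0 addr0.
have /cvgrPdist_lt/(_ e e0) := @continuous_horner R p 0.
move=> /nbhs_ballP[h /= h0 hP]; exists (h / 2); first by rewrite divr_gt0.
have h2 : 0 <= h / 2 by rewrite divr_ge0// ltW.
have := hP (h / 2); rewrite /ball/= sub0r normrN ger0_norm// => hh.
have hh2 : h / 2 < h by rewrite ltr_pdivrMr//; lra.
have := hh hh2; rewrite distrC ltr_norml pE p0 => /andP[_].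
by rewrite ltrBlDl => /ltW.
Qed.

(** The sets indexed by s need not be disjoint: this is the union bound. *)
Lemma ncard_cover (I : eqType) (T : choiceType) (s : seq I) (B : I -> set T) (A : set T) :
  (forall i, i \in s -> finite_set (B i)) ->
  (forall z, A z -> exists2 i, i \in s & B i z) ->
  (ncard A <= \sum_(i <- s) ncard (B i))%N.
Proof.
elim: s A => [|i s IHs] A fB AB.
  rewrite (_ : A = set0) ?/ncard ?fset_set0 ?cardfs0//.
  by apply/seteqP; split=> x // /AB[].
have fA : finite_set A.
  apply: (@sub_finite_set _ _ (\bigcup_(i in [set j | j \in i :: s]) B i)).
    by move=> x /AB[j js Bx]; exists j.
  by apply: bigcup_finite => // j; exact: fB.
rewrite big_cons (ncardID (B i) fA) leq_add//.
  by apply: ncard_le => [|x []//]; apply: fB; rewrite inE eqxx.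
apply: IHs => [j js|x [Ax nBx]]; first by apply: fB; rewrite inE js orbT.
by have [j] := AB x Ax; rewrite inE => /orP[/eqP->//|js Bx]; exists j.
Qed.

(** Cover K by boxes of total volume close to Vol K, widen each of them slightly to make
    it open, and take a finite subcover. The lattice points of a box are at most the
    product of its side lengths, each increased by 1, and after scaling this increase
    is negligible. *)
Lemma thick_le_Vol K e : (0 < d)%N -> compact K -> 0 < e ->
  exists2 delta, 0 < delta & exists2 t0, 0 < t0 & forall t, t0 <= t ->
    (ncard (thick t delta K))%:R <= t ^+ d * (Vol K + e).
Proof.
move=> d0 cK e0; have [B _ KB] := compact_bounded_by cK.
have e20 : 0 < e / 2 by rewrite divr_gt0.
have Kfin : lebesgue_outer K \is a fin_num by rewrite (Vol_fin d0 KB).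
have [_ [a [b [ab Kab ->]]]] := lb_ereal_inf_adherent e20 Kfin.
rewrite -/(lebesgue_outer K) (Vol_fin d0 KB) => sumab.
have /choice[h hP] : forall n, exists h : R, 0 < h /\
    \prod_j (b n 0 j - a n 0 j + 5 * h) <= \prod_j (b n 0 j - a n 0 j) + (e / 2) / (2 ^ n.+1)%:R.
  move=> n; have en0 : 0 < (e / 2) / (2 ^ n.+1)%:R :> R.
    by rewrite divr_gt0// ltr0n expn_gt0.
  by have [h h0 hle] := prod_widen (fun j => b n 0 j - a n 0 j) en0; exists h.
(* U n is the open box obtained by widening the n-th box of the cover by h n. *)
pose U n : set 'rV[R]_d := [set x | forall j, a n 0 j - h n < x 0 j < b n 0 j + h n].
have := cK; rewrite compact_cover => /(_ nat setT U)[].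
- by move=> n _; exact: open_box.
- move=> x /Kab[n _ xab]; exists n => // j; have /andP[x1 x2] := xab j.
  by have [hn0 _] := hP n; apply/andP; split; lra.
move=> D _ KD.
have [delta delta0 dh] : exists2 delta : R, 0 < delta &
    forall n, n \in enum_fset D -> delta <= h n.
  elim: (enum_fset D) => [|n s [e' e'0 IHs]]; first by exists 1.
  have [hn0 _] := hP n; exists (Num.min e' (h n)) => [|m]; first by rewrite lt_min e'0 hn0.
  by rewrite inE ge_min => /orP[/eqP->|/IHs->//]; rewrite lexx orbT.
exists delta => //; exists delta^-1; first by rewrite invr_gt0.
move=> t td; have t0 : 0 < t by apply: lt_le_trans td; rewrite invr_gt0.
have tdelta : 1 <= t * delta by rewrite -ler_pdivrMr// div1r.
(* On each side, h n comes from U n and another h n from the thickening by delta. *)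
pose A n : set 'rV[int]_d := [set p | forall j,
  t * (a n 0 j - 2 * h n) <= (p 0 j)%:~R <= t * (b n 0 j + 2 * h n)].
have AP n : finite_set (A n) /\ (n \in D -> (ncard (A n))%:R <= t ^+ d * \prod_j (b n 0 j - a n 0 j + 5 * h n)).
  have [hn0 _] := hP n.
  have [j|fA cA] := @real_box (fun j => t * (a n 0 j - 2 * h n)) (fun j => t * (b n 0 j + 2 * h n)).
    by rewrite ler_wpM2l ?(ltW t0)//; have := ab n j; lra.
  split=> // nD; apply: le_trans cA _.
  have -> : t ^+ d = \prod_(j < d) t by rewrite prodr_const card_ord.
  rewrite -big_split/=; apply: ler_prod => j _; have abj := ab n j.
  (* The sides b - a + 4 h, plus 1 / t <= h for the count, make up b - a + 5 h. *)
  have := ler_wpM2l (ltW t0) (dh n nD); move=> h1.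
  apply/andP; split; last by lra.
  by rewrite -mulrBr addr_ge0// mulr_ge0 ?(ltW t0)//; lra.
apply: (@le_trans _ _ (\sum_(n <- D) (ncard (A n)))%N%:R).
  rewrite ler_nat; apply: ncard_cover => [n _|p [x Kx px]]; first by have [] := AP n.
  have [n /= nD Ux] := KD x Kx; exists n => // j.
  have [hn0 _] := hP n.
  have := px j; rewrite ler_norml => /andP[p1 p2]; have /andP[x1 x2] := Ux j.
  have := ler_wpM2l (ltW t0) (dh n nD); move=> h1.
  have := ler_wpM2l (ltW t0) (ltW x1); have := ler_wpM2l (ltW t0) (ltW x2).
  by move=> h2 h3; apply/andP; split; lra.
rewrite natr_sum; apply: (@le_trans _ _ (\sum_(n <- D) t ^+ d * \prod_j (b n 0 j - a n 0 j + 5 * h n))).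
  by rewrite big_seq [leRHS]big_seq; apply: ler_sum => n nD; have [_] := AP n; exact.
rewrite -mulr_sumr ler_wpM2l ?exprn_ge0 ?(ltW t0)//.
pose v n := \prod_j (b n 0 j - a n 0 j) : R.
have v0 n : 0 <= v n by apply: prodr_ge0 => j _; rewrite subr_ge0.
pose N := (\max_(n <- D) n).+1.
apply: (@le_trans _ _ (\sum_(n < N) (v n + (e / 2) / (2 ^ n.+1)%:R))).
  apply: (@le_trans _ _ (\sum_(n <- D) (v n + (e / 2) / (2 ^ n.+1)%:R))).
    by apply: ler_sum => n _; have [] := hP n.
  rewrite -(big_mkord xpredT (fun n => v n + (e / 2) / (2 ^ n.+1)%:R)).
  rewrite [leRHS](bigID [in D])/= -[leLHS]addr0 lerD//; last first.
    by apply: sumr_ge0 => n _; rewrite addr_ge0// divr_ge0// ltW.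
  rewrite -[leRHS]big_filter (perm_big [seq i <- index_iota 0 N | i \in D]) ?lexx//.
  apply: uniq_perm; rewrite ?fset_uniq ?filter_uniq ?iota_uniq// => n.
  rewrite mem_filter mem_index_iota/=; have [nD|//] := boolP (n \in D).
  by rewrite ltnS/= (big_rem n)//= leq_max leqnn.
rewrite -lee_fin -sumEFin -(big_mkord xpredT (fun n => (v n + (e / 2) / (2 ^ n.+1)%:R)%:E)).
apply: le_trans (nneseries_lim_ge _ _) _ => [n _ _|].
  by rewrite lee_fin addr_ge0// divr_ge0// ltW.
have := @epsilon_trick R (fun n => (v n)%:E) (e / 2) xpredT.
move=> /(_ _ (ltW e20)) /le_trans; apply; first by move=> n; rewrite lee_fin.
have -> : (Vol K + e)%:E = ((Vol K)%:E + (e / 2)%:E + (e / 2)%:E)%E.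
  by rewrite -!EFinD; congr (_%:E); lra.
by rewrite leeD2r// ltW.
Qed.

End Lattice.

(** * Iterated sumsets of finite sets *)

Section MinkowskiSums.
Context {R : realType} {r : nat} {G : zmodType}.
Implicit Types (A : 'I_r -> set G) (n : 'I_r -> nat).

(** Sums of n i elements of each A i; the values of a i beyond n i do not matter. *)
Definition iterated_sumset A n : set G := [set s | exists2 a : 'I_r -> nat -> G,
  forall i u, (u < n i)%N -> A i (a i u) & s = \sum_i \sum_(u < n i) a i u].

Lemma iterated_sumsetE k (v : 'I_r * 'I_k.+1 -> G) n :
  iterated_sumset (fun i => range (fun j => v (i, j))) n = weighted_sums v n.
Proof.
have sumE (x : {ffun 'I_r * 'I_k.+1 -> nat}) (c : 'I_r -> nat -> 'I_k.+1) :
    (forall i j, x (i, j) = blockcount [set: 'I_(n i)] (fun u : 'I_(n i) => c i u) j) ->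
    weighted_sum v x = \sum_i \sum_(u < n i) v (i, c i u).
  move=> xc; rewrite /weighted_sum (eq_bigr (fun t => v (t.1, t.2) *+ x (t.1, t.2))) => [|[i j]//].
  rewrite -(pair_bigA _ (fun i j => v (i, j) *+ x (i, j)))/=.
  apply: eq_bigr => i _; rewrite (partition_big (fun u : 'I_(n i) => c i u) xpredT)//=.
  apply: eq_bigr => j _; rewrite xc /blockcount -sumr_const.
  apply: eq_big => u; rewrite !inE//.
  by move=> /andP[_ /eqP ->].
apply/seteqP; split=> s /=.
  move=> [a aA ->].
  have /choice[c cP] : forall iu : 'I_r * nat, exists j, (iu.2 < n iu.1)%N -> v (iu.1, j) = a iu.1 iu.2.
    move=> [i u]; have [un|nu] := boolP (u < n i)%N; last by exists ord0.
    by have [j _ <-] := aA i u un; exists j.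
  pose x : {ffun 'I_r * 'I_k.+1 -> nat} :=
    [ffun t => blockcount [set: 'I_(n t.1)] (fun u : 'I_(n t.1) => c (t.1, u : nat)) t.2].
  exists x.
    move=> i; rewrite /color_degree -[RHS](mdeg_content (fun u : 'I_(n i) => c (i, u : nat))).
    by rewrite mdegE; apply: eq_bigr => j _; rewrite ffunE contentE.
  rewrite (sumE x (fun i u => c (i, u))) => [|i j]; last by rewrite ffunE.
  by apply: eq_bigr => i _; apply: eq_bigr => u _; exact: (cP (i, u : nat) (ltn_ord u)).
move=> [x xn <-].
have /choice[c cP] : forall i, exists c : nat -> 'I_k.+1,
    forall j, x (i, j) = blockcount [set: 'I_(n i)] (fun u : 'I_(n i) => c u) j.
  move=> i; have [|f fx _] := @listing k.+1 (n i) (Multinom [tuple x (i, j) | j < k.+1]).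
    by rewrite mdegE -xn; apply: eq_bigr => j _; rewrite mnmE.
  exists (fun u => if insub u is Some u' then f u' else ord0) => j.
  have /mnmP/(_ j) := fx; rewrite contentE mnmE => <-; rewrite /blockcount.
  by apply: eq_card => u; rewrite !inE valK.
exists (fun i u => v (i, c i u)); last exact: sumE.
by move=> i u _; exists (c i u).
Qed.

Lemma eventually_poly_sumset A : (forall i, finite_set (A i)) -> (forall i, A i !=set0) ->
  eventually_poly R (fun n => ncard (iterated_sumset A n)) /\ (forall n, finite_set (iterated_sumset A n)).
Proof.
move=> fA A0; have /choice[a aA] := A0.
pose s i := enum_fset (fset_set (A i)).
pose k := (\max_i size (s i))%N.
pose v (t : 'I_r * 'I_k.+1) := nth (a t.1) (s t.1) t.2.
have AE : A = fun i => range (fun j => v (i, j)).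
  apply/funext => i; apply/seteqP; split=> x /=.
    move=> Ax; have xs : x \in s i by rewrite in_fset_set//; exact/mem_set.
    have /nthP-/(_ (a i))[m ms mx] := xs.
    have mk : (m < k.+1)%N by rewrite ltnS (leq_trans (ltnW ms))//; exact: (leq_bigmax i).
    by exists (Ordinal mk).
  move=> [j _ <-]; rewrite /v/=; have [js|sj] := ltnP j (size (s i)).
    by have := mem_nth (a i) js; rewrite /s in_fset_set// => /set_mem.
  by rewrite nth_default.
have E n : iterated_sumset A n = weighted_sums v n by rewrite AE iterated_sumsetE.
split; last by move=> n; rewrite E; exact: finite_weighted_sums.
have -> : (fun n => ncard (iterated_sumset A n)) = (fun n => ncard (weighted_sums v n)).
  by apply/funext => n; rewrite E.
exact: eventually_poly_weighted_sums.
Qed.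

End MinkowskiSums.

(** * Convex sets and splittings of integers *)

Section Convexity.
Context {R : realType} {d : nat}.
Implicit Types (K : set 'rV[R]_d).

Lemma convex_setP K : convex_set K <->
  (forall x y t, 0 <= t -> t <= 1 -> K x -> K y -> K (t *: x + (1 - t) *: y)).
Proof.
split=> [cK x y t t0 t1 Kx Ky|cK x y t /set_mem Kx /set_mem Ky].
  by have /set_mem := cK x y (Itv01 t0 t1) (mem_set Kx) (mem_set Ky).
by apply/mem_set; exact: cK.
Qed.

(** Equal weights suffice: convexity is only used to write a sum of n points of a body
    as n times one of its points. *)
Lemma convex_mean_seq K (I : eqType) (s : seq I) (y : I -> 'rV[R]_d) :
  convex_set K -> (0 < size s)%N -> (forall i, i \in s -> K (y i)) ->
  K ((size s)%:R^-1 *: \sum_(i <- s) y i).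
Proof.
move=> /convex_setP cK; elim: s => // i [|j s] IHs _ Ps.
  by rewrite big_seq1 invr1 scale1r; apply: Ps; rewrite inE.
have /(IHs isT) : forall k, k \in j :: s -> K (y k).
  by move=> k ks; apply: Ps; rewrite inE ks orbT.
have Ki : K (y i) by apply: Ps; rewrite inE eqxx.
set n := size (j :: s); set m := \sum_(_ <- _) _ => Km.
rewrite (_ : size [:: i, j & s] = n.+1)// big_cons -/m.
have n0 : n%:R != 0 :> R by rewrite pnatr_eq0.
have n1 : n%:R + 1 != 0 :> R by rewrite natr1 pnatr_eq0.
have -> : n.+1%:R^-1 *: (y i + m) = n.+1%:R^-1 *: y i + (1 - n.+1%:R^-1) *: (n%:R^-1 *: m).
  rewrite scalerDr scalerA; congr (_ + _ *: _).
  by rewrite -natr1; field; rewrite n0.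
apply: cK => //.
by rewrite invf_le1 ?ler1n// ltr0n.
Qed.

Lemma convex_mean K (I : finType) (P : pred I) (y : I -> 'rV[R]_d) :
  convex_set K -> (0 < #|P|)%N -> (forall i, P i -> K (y i)) ->
  K ((#|P|%:R)^-1 *: \sum_(i | P i) y i).
Proof.
move=> cK P0 Ky; rewrite (eq_bigl (fun i => i \in P))// -big_enum/= cardE.
apply: convex_mean_seq => // [|i]; first by rewrite -cardE.
by rewrite mem_enum; exact: Ky.
Qed.

End Convexity.

(** The unit added at each step goes to any index that is not yet full. *)
Lemma exists_split (I : finType) (c : I -> nat) w : (w <= \sum_i c i)%N ->
  exists2 f : I -> nat, forall i, (f i <= c i)%N & (\sum_i f i = w)%N.
Proof.
elim: w => [_|w IHw wc]; first by exists (fun=> 0%N) => //; rewrite big1.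
have [f fc fw] := IHw (ltnW wc).
have [i fi] : exists i, (f i < c i)%N.
  apply/existsP; apply: contraTT wc; rewrite negb_exists => /forallP cf.
  rewrite -leqNgt -fw; apply: leq_sum => i _; by rewrite leqNgt cf.
exists (fun j => f j + (j == i))%N => [j|].
  by case: eqP => [->|_]; rewrite ?addn1 ?addn0.
rewrite big_split/= fw (bigD1 i)//= eqxx big1 ?addn0 ?addn1// => j /negbTE->.
by [].
Qed.

(** * Lattice points of Minkowski combinations as sumsets *)

Section Discretization.
Context {R : realType} {d r : nat}.
Variables (K : 'I_r -> set 'rV[R]_d) (B : R).
Hypotheses (K0 : forall i, K i !=set0) (KB : forall i, bounded_by B (K i)).
Hypothesis cK : forall i, convex_set (K i).

(** Integer parts of the points of N L, plus all vertices of the unit cube. The vertices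
    make room for rounding errors: a sum of n such points can be corrected by any
    integer vector with coordinates between 0 and n. *)
Definition discretize (N : nat) (L : set 'rV[R]_d) : set 'rV[int]_d :=
  [set p | exists2 y, L y & exists e : 'I_d -> bool,
    p = floor_vec (N%:R *: y) + \row_j (e j : nat)%:Z].

Lemma discretize_close N L p : discretize N L p ->
  exists2 y, L y & forall j, `|(p 0 j)%:~R - N%:R * y 0 j| <= 1.
Proof.
move=> [y Ly [e ->]]; exists y => // j; rewrite !mxE intrD.
have /andP[h1 h2] := floor_itv (N%:R * y 0 j); rewrite intrD in h2.
by rewrite ler_norml; case: (e j) => /=; apply/andP; split; lra.
Qed.

Lemma finite_discretize (N : nat) L : (0 < N)%N -> bounded_by B L -> finite_set (discretize N L).
Proof.
move=> N0 LB; apply: sub_finite_set (finite_thick N%:R N%:R^-1 LB) => p /discretize_close[y Ly py].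
by exists y => // j; rewrite mulfV// pnatr_eq0 -lt0n.
Qed.

Lemma discretize_neq0 N L : L !=set0 -> discretize N L !=set0.
Proof.
move=> [y Ly]; exists (floor_vec (N%:R *: y)); exists y => //; exists (fun=> false).
by apply/rowP => j; rewrite !mxE addr0.
Qed.

Lemma bounded_comb (l : 'I_r -> R) : (forall i, 0 <= l i) ->
  bounded_by (\sum_i l i * B) (minkowski_comb l K).
Proof.
move=> l0 _ [y Ky ->] j; rewrite summxE (le_trans (ler_norm_sum _ _ _))//.
apply: ler_sum => i _; rewrite mxE normrM ger0_norm// ler_wpM2l//.
exact: KB.
Qed.

(** A point of m N times the Minkowski combination is a sum of m l_i N y_i. Replace m l_i
    by its integer part and N y_i by its integer part: the error in each coordinate is
    at most r c from the first replacement, which is independent of m, and at most the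
    number of summands from the second one. After a fixed translation the error is
    nonnegative and is absorbed by the unit cubes in discretize, thanks to q more
    summands of each kind. *)
Lemma floors_le_sumset (N c m q : nat) (l : 'I_r -> R) : (0 < N)%N ->
  N%:R * B <= c%:R -> (2 * c <= q)%N -> (forall i, 0 <= l i) ->
  (ncard (floors (m * N)%:R (minkowski_comb l K)) <=
   ncard (iterated_sumset (fun i => discretize N (K i)) (fun i => Num.truncn (m%:R * l i) + q)))%N.
Proof.
move=> N0 NBc cq l0; set n := fun i => Num.truncn (m%:R * l i).
have /choice[y0 Ky0] := K0.
have fA i : finite_set (discretize N (K i)) by apply: finite_discretize => //; exact: KB.
have [_ fm] := eventually_poly_sumset (R := R) fA (fun i => discretize_neq0 N (K0 i)).
(* The constant r c makes the rounding errors nonnegative; the other term accounts for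
   the q extra summands of each kind, all equal to a fixed point y0 i. *)
pose shift : 'rV[int]_d := const_mx (r * c)%:Z + \sum_i floor_vec (N%:R *: y0 i) *+ q.
rewrite -(ncard_inj (f := fun p => p + shift)); last 2 first.
- exact: finite_floors (bounded_comb l0).
- by move=> p p' _ _ /addIr.
apply: ncard_le; first exact: fm.
move=> _ [_ [_ [y Ky ->] <-] <-]; set z := _ *: _.
pose F j : int := \sum_i Num.floor (N%:R * y i 0 j) *+ n i.
have nl i : 0 <= m%:R * l i - (n i)%:R <= 1.
  have ml0 : 0 <= m%:R * l i by rewrite mulr_ge0.
  have := truncn_itv ml0; rewrite -/(n i) -natr1 => /andP[h1 h2].
  by apply/andP; split; lra.
have wj j : exists w : nat, (w <= \sum_i (n i + q))%N /\
    Num.floor (z 0 j) + (r * c)%:Z = F j + w%:Z.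
  have zE : z 0 j = \sum_i (m * N)%:R * (l i * y i 0 j).
    rewrite /z mxE summxE mulr_sumr; apply: eq_bigr => i _; by rewrite mxE.
  have bnd i : - c%:R <= (m%:R * l i - (n i)%:R) * (N%:R * y i 0 j) <= c%:R.
    rewrite -ler_norml normrM; have /andP[h1 h2] := nl i.
    rewrite ger0_norm// -[leRHS]mul1r ler_pM// normrM ger0_norm//.
    by apply: le_trans NBc; rewrite ler_wpM2l//; exact: KB.
  have fl i : 0 <= (n i)%:R * (N%:R * y i 0 j) - (Num.floor (N%:R * y i 0 j) *+ n i)%:~R <= (n i)%:R.
    rewrite [X in _ - X](_ : _ = (n i)%:R * (Num.floor (N%:R * y i 0 j))%:~R); last first.
      by rewrite rmorphMn/= [RHS]mulr_natl.
    rewrite -mulrBr.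
    have /andP[h1 h2] := floor_itv (N%:R * y i 0 j); rewrite intrD in h2.
    apply/andP; split; first by rewrite mulr_ge0// subr_ge0.
    by rewrite -[leRHS]mulr1 ler_wpM2l//; lra.
  have zF : z 0 j - (F j)%:~R = \sum_i ((m%:R * l i - (n i)%:R) * (N%:R * y i 0 j) +
     ((n i)%:R * (N%:R * y i 0 j) - (Num.floor (N%:R * y i 0 j) *+ n i)%:~R)).
    rewrite zE /F rmorph_sum/= -sumrB; apply: eq_bigr => i _.
    by rewrite natrM; ring.
  have rcE : (r * c)%:R = \sum_(i < r) c%:R :> R by rewrite sumr_const card_ord natrM mulr_natl.
  have zF1 : - (r * c)%:R <= z 0 j - (F j)%:~R.
    rewrite zF rcE -sumrN.
    apply: ler_sum => i _; have /andP[h1 _] := bnd i; have /andP[h2 _] := fl i.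
    by rewrite -[leLHS]addr0 lerD.
  have zF2 : z 0 j - (F j)%:~R <= (r * c)%:R + (\sum_i n i)%N%:R.
    rewrite zF rcE natr_sum -big_split/=.
    apply: ler_sum => i _; have /andP[_ h1] := bnd i; have /andP[_ h2] := fl i.
    by rewrite lerD.
  have /andP[z1 z2] := floor_itv (z 0 j); rewrite intrD in z2.
  have w0 : 0 <= Num.floor (z 0 j) + (r * c)%:Z - F j.
    rewrite -ltzD1 -(ltr_int R) !rmorphD rmorphN/= -pmulrn/=; lra.
  have w1 : Num.floor (z 0 j) + (r * c)%:Z - F j <= (2 * (r * c) + \sum_i n i)%N.
    rewrite -(ler_int R) !rmorphD rmorphN/= -!pmulrn; lra.
  exists `|(Num.floor (z 0 j) + (r * c)%:Z - F j)%R|%N; split; last first.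
    by rewrite gez0_abs// [RHS]addrCA subrr addr0.
  rewrite big_split/= sum_nat_const card_ord.
  apply: (@leq_trans (2 * (r * c) + \sum_i n i)%N); first by rewrite -lez_nat gez0_abs.
  by rewrite addnC leq_add2l mulnCA leq_mul2l cq orbT.
have /choice[w wP] := wj.
have /choice[g gP] : forall j, exists f : 'I_r -> nat,
    (forall i, (f i <= n i + q)%N) /\ (\sum_i f i = w j)%N.
  by move=> j; have [wle _] := wP j; have [f f1 f2] := exists_split wle; exists f.
exists (fun i u => floor_vec (N%:R *: (if (u < n i)%N then y i else y0 i)) +
   \row_j ((u < g j i)%N : nat)%:Z).
  move=> i u _; exists (if (u < n i)%N then y i else y0 i); first by case: ifP.
  by exists (fun j => u < g j i)%N.
have sumlt a b : (a <= b)%N -> (\sum_(u < b) (u < a) = a)%N.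
  move=> ab; rewrite -[RHS]card_ord -(subnKC ab) big_split_ord/=.
  rewrite (eq_bigr (fun=> 1%N)) => [|u _]; last by rewrite ltn_ord.
  rewrite sum_nat_const muln1 big1 ?addn0// => u _.
  by rewrite ltnNge leq_addr.
apply/rowP => j; have [_ wE] := wP j; have [gle gs] := gP j.
transitivity (F j + (w j)%:Z + \sum_i Num.floor (N%:R * y0 i 0 j) *+ q).
  have -> : (floor_vec z + shift) 0 j = Num.floor (z 0 j) +
      ((r * c)%:Z + \sum_i (floor_vec (N%:R *: y0 i) *+ q) 0 j).
    by rewrite /shift mxE [in LHS]mxE [X in _ + X]mxE [X in _ + (X + _)]mxE summxE.
  rewrite addrA wE; congr (_ + _).
  by apply: eq_bigr => i _; rewrite mulmxnE !mxE.
rewrite summxE -gs (_ : (\sum_i g j i)%N%:Z = \sum_i (g j i)%:Z); last first.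
  by rewrite -natz natr_sum; apply: eq_bigr => i _; rewrite natz.
rewrite /F -!big_split/=; apply: eq_bigr => i _.
rewrite summxE (eq_bigr (fun u : 'I_(n i + q) =>
  Num.floor (N%:R * (if (u < n i)%N then y i else y0 i) 0 j) + (u < g j i)%N%:Z)); last first.
  by move=> u _; rewrite !mxE.
rewrite big_split/= -[in LHS](sumlt _ _ (gle i)) addrAC; congr (_ + _); last first.
  by rewrite -natz natr_sum; apply: eq_bigr => u _; rewrite natz.
rewrite big_split_ord/= -[X in _ *+ X + _](card_ord (n i)) -[X in _ + _ *+ X](card_ord q).
rewrite -!sumr_const; congr (_ + _); apply: eq_bigr => u _; first by rewrite ltn_ord.
by rewrite ltnNge leq_addr.
Qed.

(** By convexity the sum of n elements of K_i is n times an element of K_i, and each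
    element of discretize N K_i is at distance at most 1 from N K_i. *)
Lemma sumset_sub_thick (N m q : nat) (l : 'I_r -> R) (delta : R) : 0 <= B ->
  (0 < q)%N -> (forall i, 0 <= l i) ->
  (\sum_i (Num.truncn (m%:R * l i) + q))%N%:R + r%:R * (N%:R * q.+1%:R * B) <=
    (m * N)%:R * delta ->
  iterated_sumset (fun i => discretize N (K i)) (fun i => Num.truncn (m%:R * l i) + q)%N `<=`
  thick (m * N)%:R delta (minkowski_comb l K).
Proof.
move=> B0 q0 l0 hdelta s [a aA ->].
have /choice[y yP] : forall iu : 'I_r * nat, exists y : 'rV[R]_d,
    (iu.2 < Num.truncn (m%:R * l iu.1) + q)%N ->
    K iu.1 y /\ forall j, `|(a iu.1 iu.2 0 j)%:~R - N%:R * y 0 j| <= 1.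
  move=> [i u] /=; have [un|] := boolP (u < Num.truncn (m%:R * l i) + q)%N; last by exists 0.
  by have [y Ky ay] := discretize_close (aA i u un); exists y.
set n := fun i => (Num.truncn (m%:R * l i) + q)%N.
have n0 i : (0 < n i)%N by rewrite /n addn_gt0 q0 orbT.
pose yb i := (n i)%:R^-1 *: \sum_(u < n i) y (i, u : nat).
have Kyb i : K i (yb i).
  have := @convex_mean _ _ (K i) 'I_(n i) predT (fun u => y (i, u : nat)) (@cK i).
  rewrite card_ord; apply => // u _.
  by have [] := yP (i, u : nat) (ltn_ord u).
exists (\sum_i l i *: yb i); first by exists yb.
move=> j; apply: le_trans hdelta.
rewrite !summxE rmorph_sum/= mulr_sumr -sumrB (le_trans (ler_norm_sum _ _ _))//.
have -> : r%:R * (N%:R * q.+1%:R * B) = \sum_(i < r) N%:R * q.+1%:R * B.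
  by rewrite sumr_const card_ord [LHS]mulr_natl.
rewrite natr_sum -big_split/=; apply: ler_sum => i _.
have nE : (n i)%:R * yb i 0 j = \sum_(u < n i) y (i, u : nat) 0 j.
  by rewrite mxE summxE mulVKf// pnatr_eq0 -lt0n.
rewrite [X in _ - _ * X]mxE summxE rmorph_sum/= -/(n i).
have -> : \sum_(u < n i) (a i u 0 j)%:~R - (m * N)%:R * (l i * yb i 0 j) =
    \sum_(u < n i) ((a i u 0 j)%:~R - N%:R * y (i, u : nat) 0 j) +
    N%:R * (((n i)%:R - m%:R * l i) * yb i 0 j).
  by rewrite sumrB -mulr_sumr -nE natrM; ring.
rewrite (le_trans (ler_normD _ _))// lerD//.
  rewrite (le_trans (ler_norm_sum _ _ _))//.
  rewrite -[X in _ <= X%:R]card_ord -sumr_const; apply: ler_sum => u _.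
  by have [_] := yP (i, u : nat) (ltn_ord u); exact.
rewrite -mulrA normrM normr_nat ler_wpM2l// normrM ler_pM//; last exact: KB.
have ml0 : 0 <= m%:R * l i by rewrite mulr_ge0.
have := truncn_itv ml0; rewrite /n natrD -!natr1 => /andP[h1 h2].
by rewrite ler_norml; have : 0 <= q%:R :> R by []; move=> ?; apply/andP; split; lra.
Qed.

End Discretization.

(** * Leading forms as limits *)

Section Limits.
Context {R : realType}.
Implicit Types (f : nat -> R) (a : R).

Lemma cvg_sum_seq (I : Type) (s : seq I) (P : pred I) (f : I -> nat -> R) (a : I -> R) :
  (forall i, P i -> f i @ \oo --> a i) ->
  (fun m => \sum_(i <- s | P i) f i m) @ \oo --> \sum_(i <- s | P i) a i.
Proof.
move=> fa; elim: s => [|i s IHs].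
  rewrite big_nil; under eq_fun do rewrite big_nil; exact: cvg_cst.
rewrite big_cons; under eq_fun do rewrite big_cons.
by case: ifP => // Pi; apply: cvgD => //; exact: fa.
Qed.

Lemma cvg_prod_seq (I : Type) (s : seq I) (P : pred I) (f : I -> nat -> R) (a : I -> R) :
  (forall i, P i -> f i @ \oo --> a i) ->
  (fun m => \prod_(i <- s | P i) f i m) @ \oo --> \prod_(i <- s | P i) a i.
Proof.
move=> fa; elim: s => [|i s IHs].
  rewrite big_nil; under eq_fun do rewrite big_nil; exact: cvg_cst.
rewrite big_cons; under eq_fun do rewrite big_cons.
by case: ifP => // Pi; apply: cvgM => //; exact: fa.
Qed.

Lemma cvg_expr f a n : f @ \oo --> a -> (fun m => f m ^+ n) @ \oo --> a ^+ n.
Proof.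
move=> fa; elim: n => [|n IHn].
  rewrite expr0; under eq_fun do rewrite expr0; exact: cvg_cst.
by rewrite exprS; under eq_fun do rewrite exprS; exact: cvgM.
Qed.

Lemma cvg_natV : (fun m : nat => m%:R^-1 : R) @ \oo --> (0 : R).
Proof. by rewrite -cvg_shiftS; exact: cvg_harmonic. Qed.

(** The coefficients g e are allowed to depend on m, as they come from values of a
    polynomial at points that move with m. *)
Lemma cvg_top_coef (g : nat -> nat -> R) (v : nat -> R) E :
  (forall e, (e <= E)%N -> g e @ \oo --> v e) ->
  (fun m : nat => (\sum_(e < E.+1) m%:R ^+ e * g e m) / m%:R ^+ E : R) @ \oo --> v E.
Proof.
elim: E => [|E IHE] gv.
  under eq_fun do rewrite big_ord_recl big_ord0 addr0 expr0 mul1r divr1.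
  exact: gv.
have IH : (fun m : nat => m%:R^-1 * ((\sum_(e < E.+1) m%:R ^+ e * g e m) / m%:R ^+ E) + g E.+1 m : R)
    @ \oo --> v E.+1.
  have H := IHE (fun e eE => gv e (leqW eE)).
  have -> : v E.+1 = 0 * v E + v E.+1 by rewrite mul0r add0r.
  apply: cvgD; last exact: gv.
  by apply: cvgM; [exact: cvg_natV | exact: H].
apply: cvg_trans IH; apply: near_eq_cvg; near=> m.
have m0 : m%:R != 0 :> R by rewrite pnatr_eq0 -lt0n; near: m; exact: nbhs_infty_gt.
rewrite [in RHS]big_ord_recr/= mulrDl [X in _ = _ + X]mulrAC mulfV ?expf_neq0// mul1r.
by rewrite exprS invfM mulrCA mulrA.
Unshelve. all: by end_near. Qed.

Lemma cvg_bounded_le0 f (a C : R) : f @ \oo --> a ->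
  (\forall m \near \oo, `|f m| <= C / m%:R) -> a = 0.
Proof.
move=> fa fC; have C0 : (fun m : nat => C / m%:R) @ \oo --> (0 : R).
  by rewrite -(mulr0 C); apply: cvgM; [exact: cvg_cst | exact: cvg_natV].
have f0 : f @ \oo --> (0 : R).
  apply: (squeeze_cvgr (f := fun m : nat => - (C / m%:R)) (h := fun m : nat => C / m%:R)) => //.
    by near=> m; rewrite -ler_norml; near: m.
  by rewrite -oppr0; exact: cvgN.
exact: (cvg_unique _ fa f0).
Unshelve. all: by end_near. Qed.

Variable r : nat.
Implicit Types (P : mpoly r R) (l : 'I_r -> R).

Lemma cvg_hom_part e P l (x : nat -> 'I_r -> R) : (forall i, x^~ i @ \oo --> l i) ->
  (fun m => hom_part e P (x m)) @ \oo --> hom_part e P l.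
Proof.
move=> xl; rewrite /hom_part; apply: cvg_sum_seq => a _.
apply: cvgM; first exact: cvg_cst.
by apply: cvg_prod_seq => i _; exact: cvg_expr.
Qed.

(** If P grows at most like m^d along m x_m, for sequences x_m tending to every l >= 0,
    then its components of degree e > d vanish: for the highest nonzero one, P divided
    by m^e tends both to its value and to 0. What remains of P divided by m^d tends to
    the component of degree d. *)
Lemma cvg_leading_form d P (x : ('I_r -> R) -> nat -> 'I_r -> R) (C : ('I_r -> R) -> R) :
  (forall l, (forall i, 0 <= l i) -> [/\ (forall m i, 0 <= x l m i),
     (forall i, (x l)^~ i @ \oo --> l i) &
     \forall m \near \oo, `|meval (fun i => m%:R * x l m i) P| <= C l * m%:R ^+ d]) ->
  forall l, (forall i, 0 <= l i) ->
    (fun m : nat => meval (fun i => m%:R * x l m i) P / m%:R ^+ d : R) @ \oo --> hom_part d P l.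
Proof.
move=> Hx.
pose D := maxn d (\max_(a <- msupp P) mdeg a)%N.
have PD (a : multinom r) : a \in msupp P -> (mdeg a <= D)%N.
  by move=> aP; rewrite /D leq_max; apply/orP; right; rewrite (big_rem a)//= leq_max leqnn.
have top E l : (forall i, 0 <= l i) -> (E <= D)%N ->
    (forall e, (E < e <= D)%N -> forall l', (forall i, 0 <= l' i) -> hom_part e P l' = 0) ->
    (fun m : nat => meval (fun i => m%:R * x l m i) P / m%:R ^+ E : R) @ \oo --> hom_part E P l.
  move=> l0 ED van; have [x0 xl _] := Hx l l0.
  have -> : (fun m : nat => meval (fun i => m%:R * x l m i) P / m%:R ^+ E : R) =
      (fun m : nat => (\sum_(e < E.+1) m%:R ^+ e * hom_part e P (x l m)) / m%:R ^+ E : R).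
    apply/funext => m; congr (_ / _); rewrite (meval_hom_part _ PD).
    rewrite -(big_mkord xpredT (fun e => hom_part e P (fun i => m%:R * x l m i))).
    rewrite (big_cat_nat (n := E.+1))//= [X in _ + X]big_nat [X in _ + X]big1 ?addr0.
      by rewrite big_mkord; apply: eq_bigr => e _; rewrite hom_partZ.
    by move=> e Ee; rewrite hom_partZ van ?mulr0//; lia.
  apply: (@cvg_top_coef (fun e m => hom_part e P (x l m)) (fun e => hom_part e P l) E).
  by move=> e _; exact: cvg_hom_part xl.
have van k : forall e, (d < e <= D)%N -> (D < e + k)%N ->
    forall l, (forall i, 0 <= l i) -> hom_part e P l = 0.
  elim: k => [|k IHk] e de Dek l l0; first by lia.
  have [x0 xl xC] := Hx l l0.
  have := top e l l0; have -> : (e <= D)%N by lia.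
  move=> /(_ isT) H; apply: (cvg_bounded_le0 (C := `|C l|) (H _)) => [e' e'D l' l'0|].
    by apply: (IHk e') => //; lia.
  near=> m.
  have m0 : 0 < m%:R :> R by rewrite ltr0n; near: m; exact: nbhs_infty_gt.
  have m1 : 1 <= m%:R :> R by rewrite ler1n -(ltr0n R).
  rewrite normrM normfV (ger0_norm (exprn_ge0 _ (ltW m0))) ler_pdivrMr ?exprn_gt0//.
  have : `|meval (fun i => m%:R * x l m i) P| <= C l * m%:R ^+ d by near: m.
  move=> /le_trans; apply; apply: (@le_trans _ _ (`|C l| * m%:R ^+ d)).
    by rewrite ler_wpM2r ?exprn_ge0 ?ler_norm// ltW.
  rewrite -mulrA ler_wpM2l//.
  have -> : e = (e.-1).+1 by lia.
  by rewrite exprS mulKf ?gt_eqF// ler_weXn2l//; lia.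
move=> l l0; apply: top => //; first by rewrite /D leq_maxl.
by move=> e eD l' l'0; apply: (van D.+1) => //; lia.
Unshelve. all: by end_near. Qed.

End Limits.

(** * Polynomiality of the volume of Minkowski combinations *)

Section MixedVolume.
Context {R : realType} {d r : nat}.
Implicit Types (K : 'I_r -> set 'rV[R]_d) (l : 'I_r -> R).

Import ArrowAsProduct.

(** A continuous image of a product of compact sets. *)
Lemma compact_comb l K : (forall i, compact (K i)) -> compact (minkowski_comb l K).
Proof.
move=> cK; pose f (y : 'I_r -> 'rV[R]_d) := \sum_i l i *: y i.
have -> : minkowski_comb l K = f @` [set y | forall i, K i (y i)].
  by apply/seteqP; split=> x [y Ky yx]; exists y.
apply: continuous_compact; last exact: tychonoff.
apply: continuous_subspaceT => y; rewrite /f.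
have FF : Filter (nbhs (y : prod_topology (fun=> 'rV[R]_d))) by exact: nbhs_filter.
apply: cvg_big => [|i _]; first exact: add_continuous.
apply: cvgZ; first exact: cvg_cst.
exact: (@proj_continuous _ (fun=> 'rV[R]_d) i y).
Qed.

(** A crude bound: the points lie in a cube. It serves only to bound degrees. *)
Lemma ncard_thick_le (L : set 'rV[R]_d) (B t e : R) : 0 <= t -> 0 <= B -> 0 <= e ->
  bounded_by B L -> (ncard (thick t e L))%:R <= (2 * (t * (B + e)) + 1) ^+ d.
Proof.
move=> t0 B0 e0 LB; pose C := t * (B + e).
have C0 : 0 <= C by rewrite mulr_ge0// addr_ge0.
have [|fA cA] := @real_box R d (fun=> - C) (fun=> C); first by move=> j; lra.
have TA : thick t e L `<=` [set p | forall j : 'I_d, - C <= (p 0 j)%:~R <= C].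
  move=> p [x Lx px] j; have := px j; have xB := LB x Lx j.
  move=> pxj; rewrite -ler_norml /C mulrDr -(subrK (t * x 0 j) (_%:~R)).
  rewrite (le_trans (ler_normD _ _))// addrC lerD//.
  by rewrite normrM ger0_norm// ler_wpM2l.
apply: (@le_trans _ _ (\prod_(j < d) (C - - C + 1))).
  by apply: le_trans cA; rewrite ler_nat; apply: ncard_le.
by rewrite prodr_const card_ord opprK -mulr2n mulr_natl.
Qed.

(** The form in question is the degree d part of the polynomial that counts the sumsets
    of the discretizations of N K_i. For fixed N its values are limits, as m grows, of
    normalized cardinalities, which lie between the volume and the normalized number of
    lattice points of a neighbourhood of size O(1 / N). *)
Lemma Vol_approx K : (0 < d)%N -> (forall i, convex_body (K i)) ->
  exists P : nat -> mpoly r R, forall l, (forall i, 0 <= l i) ->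
    (fun N : nat => hom_part d (P N) l / N%:R ^+ d : R) @ \oo --> Vol (minkowski_comb l K).
Proof.
move=> d0 bK.
have K0 i : K i !=set0 by have [] := bK i.
have cK i : compact (K i) by have [] := bK i.
have vK i : convex_set (K i) by have [] := bK i.
have /choice[Bf BfP] : forall i, exists B, 0 < B /\ bounded_by B (K i).
  by move=> i; have [B B0 KB] := compact_bounded_by (cK i); exists B.
pose B := \sum_i Bf i.
have B0 : 0 <= B by apply: sumr_ge0 => i _; have [/ltW] := BfP i.
have KB i : bounded_by B (K i).
  move=> x Kx j; have [_ /(_ x Kx j) h] := BfP i; apply: (le_trans h).
  by rewrite /B (bigD1 i)//= lerDl sumr_ge0// => k _; have [/ltW] := BfP k.
pose A N i := discretize N (K i).
have /choice[F FP] : forall N : nat, exists qP : nat * mpoly r R, (0 < N)%N ->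
    forall n, (forall i, (qP.1 <= n i)%N) -> (ncard (iterated_sumset (A N) n))%:R = meval (fun i => (n i)%:R) qP.2.
  move=> N; have [->|N0] := posnP N; first by exists (0%N, 0).
  have fA i : finite_set (A N i) by apply: finite_discretize => //; exact: KB.
  have [[q [P HP]] _] := eventually_poly_sumset (R := R) fA (fun i => discretize_neq0 N (K0 i)).
  by exists (q, P).
exists (fun N => (F N).2) => l l0.
pose V := Vol (minkowski_comb l K); rewrite -/V.
pose c N := (Num.truncn (N%:R * B)).+1.
have NBc N : N%:R * B <= (c N)%:R by apply/ltW; exact: truncnS_gt.
(* Large enough both for the counting polynomial and for absorbing rounding errors. *)
pose q N := maxn (F N).1 (2 * c N)%N.
have q0 N : (0 < q N)%N by rewrite /q leq_max orbC muln_gt0.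
pose n N (l : 'I_r -> R) m i := (Num.truncn (m%:R * l i) + q N)%N.
(* The part independent of m of the distance between the sumset and the dilated body. *)
pose e N (l : 'I_r -> R) := (r * q N)%:R + r%:R * (N%:R * (q N).+1%:R * B).
have nle N l' m : (forall i, 0 <= l' i) ->
    (\sum_i (n N l' m i))%N%:R + r%:R * (N%:R * (q N).+1%:R * B) <= m%:R * \sum_i l' i + e N l'.
  move=> l'0; rewrite /e addrA lerD2r big_split/= sum_nat_const card_ord natrD lerD2r.
  rewrite natr_sum mulr_sumr; apply: ler_sum => i _.
  by have /andP[] : (Num.truncn (m%:R * l' i))%:R <= m%:R * l' i < (Num.truncn (m%:R * l' i)).+1%:R
    by apply: truncn_itv; rewrite mulr_ge0.
have e0 N l' : 0 <= e N l' by rewrite /e addr_ge0// !mulr_ge0.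
have bC l' (l'0 : forall i, 0 <= l' i) := bounded_comb KB l'0.
have fin N l' m : (0 < N)%N -> finite_set (iterated_sumset (A N) (n N l' m)).
  move=> N0; have fA i : finite_set (A N i) by apply: finite_discretize => //; exact: KB.
  by have [_] := eventually_poly_sumset (R := R) fA (fun i => discretize_neq0 N (K0 i)).
have mE N l' m : (0 < N)%N -> (0 < m)%N ->
    meval (fun i => m%:R * ((n N l' m i)%:R / m%:R)) (F N).2 = (ncard (iterated_sumset (A N) (n N l' m)))%:R.
  move=> N0 m0; rewrite (FP N N0) => [|i].
    by apply: meval_eq => i; rewrite mulrCA mulfV ?mulr1// pnatr_eq0 -lt0n.
  by rewrite /n /q; lia.
have up N l' m delta : (0 < N)%N -> (forall i, 0 <= l' i) ->
    m%:R * \sum_i l' i + e N l' <= (m * N)%:R * delta ->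
    (ncard (iterated_sumset (A N) (n N l' m)) <= ncard (thick (m * N)%:R delta (minkowski_comb l' K)))%N.
  move=> N0 l'0 he; apply: ncard_le; first exact: finite_thick (bC l' l'0).
  apply: (@sumset_sub_thick _ _ _ K B KB vK) => //.
  by apply: le_trans he; exact: nle.
have lim N : (0 < N)%N -> (fun m : nat => meval (fun i => m%:R * ((n N l m i)%:R / m%:R)) (F N).2 / m%:R ^+ d : R)
    @ \oo --> hom_part d (F N).2 l.
  move=> N0; have N1 : 1 <= N%:R :> R by rewrite ler1n.
  pose dl (l' : 'I_r -> R) := \sum_i l' i + e N l'.
  apply: (@cvg_leading_form _ _ d (F N).2 (fun l' m i => (n N l' m i)%:R / m%:R)
    (fun l' => (2 * (N%:R * (\sum_i l' i * B + dl l')) + 1) ^+ d)) => // l' l'0.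
  have sl0 : 0 <= \sum_i l' i by apply: sumr_ge0.
  split=> [m i|i|]; first by rewrite divr_ge0.
    apply: (squeeze_cvgr (f := fun m : nat => l' i + (q N)%:R * m%:R^-1 - m%:R^-1 : R)
       (h := fun m : nat => l' i + (q N)%:R * m%:R^-1 : R)).
    - near=> m; have m0 : 0 < m%:R :> R by rewrite ltr0n; near: m; exact: nbhs_infty_gt.
      have /andP[h1 h2] : (Num.truncn (m%:R * l' i))%:R <= m%:R * l' i < (Num.truncn (m%:R * l' i)).+1%:R.
        by apply: truncn_itv; rewrite mulr_ge0// ltW.
      rewrite /n natrD mulrDl; rewrite -natr1 in h2.
      have h1' : (Num.truncn (m%:R * l' i))%:R / m%:R <= l' i by rewrite ler_pdivrMr// [l' i * _]mulrC.
      have h2' : l' i - m%:R^-1 <= (Num.truncn (m%:R * l' i))%:R / m%:R.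
        by rewrite ler_pdivlMr// mulrBl mulVf ?gt_eqF// [l' i * _]mulrC; lra.
      by apply/andP; split; lra.
    - have H : (fun m : nat => l' i + (q N)%:R * m%:R^-1 - m%:R^-1 : R) @ \oo --> l' i + (q N)%:R * 0 - 0.
        apply: cvgB; last exact: cvg_natV.
        by apply: cvgD; [exact: cvg_cst | apply: cvgM; [exact: cvg_cst | exact: cvg_natV]].
      by rewrite mulr0 addr0 subr0 in H.
    - have H : (fun m : nat => l' i + (q N)%:R * m%:R^-1 : R) @ \oo --> l' i + (q N)%:R * 0.
        by apply: cvgD; [exact: cvg_cst | apply: cvgM; [exact: cvg_cst | exact: cvg_natV]].
      by rewrite mulr0 addr0 in H.
  near=> m; have m0 : (0 < m)%N by near: m; exact: nbhs_infty_gt.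
  have m1 : 1 <= m%:R :> R by rewrite ler1n.
  rewrite mE// ger0_norm//.
  have dl0 : 0 <= dl l' by rewrite /dl addr_ge0.
  have he : m%:R * \sum_i l' i + e N l' <= (m * N)%:R * dl l'.
    rewrite natrM -mulrA; apply: (@le_trans _ _ (m%:R * dl l')).
      by rewrite /dl mulrDr lerD2l ler_peMl.
    by rewrite ler_wpM2l// ler_peMl.
  apply: (@le_trans _ _ (ncard (thick (m * N)%:R (dl l') (minkowski_comb l' K)))%:R).
    by rewrite ler_nat up.
  have lB0 : 0 <= \sum_i l' i * B by apply: sumr_ge0 => i _; rewrite mulr_ge0.
  apply: le_trans (ncard_thick_le _ _ _ (bC l' l'0)) _ => //.
  rewrite -exprMn lerXn2r ?nnegrE//.
  - by rewrite addr_ge0// !mulr_ge0// addr_ge0.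
  - by rewrite mulr_ge0// addr_ge0// !mulr_ge0// addr_ge0.
  - by rewrite natrM; lra.
apply/cvgrPdist_le => eps eps0.
have [delta delta0 [t0 t00 tP]] := thick_le_Vol d0 (compact_comb (l := l) cK) eps0.
near=> N.
have N0 : (0 < N)%N by near: N; exact: nbhs_infty_gt.
have NR : 0 < N%:R :> R by rewrite ltr0n.
have Nd : \sum_i l i + 1 <= N%:R * delta.
  by rewrite -ler_pdivrMr//; near: N; exact: nbhs_infty_ger.
have h1 : N%:R ^+ d * V <= hom_part d (F N).2 l.
  apply: (cvgr_to_ge (lim N N0)); near=> m.
  have m0 : (0 < m)%N by near: m; exact: nbhs_infty_gt.
  rewrite mE// ler_pdivlMr ?exprn_gt0 ?ltr0n// mulrAC -exprMn -natrM mulnC.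
  apply: (@le_trans _ _ (ncard (floors (m * N)%:R (minkowski_comb l K)))%:R).
    by apply: Vol_le_floors (bC l l0) _; rewrite ?ltr0n ?muln_gt0 ?m0.
  have qc : (2 * c N <= q N)%N by rewrite /q leq_maxr.
  have := @floors_le_sumset _ _ _ K B K0 KB N (c N) m (q N) l N0 (NBc N) qc l0.
  by rewrite ler_nat.
have h2 : hom_part d (F N).2 l <= N%:R ^+ d * (V + eps).
  apply: (cvgr_to_le (lim N N0)); near=> m.
  have m0 : (0 < m)%N by near: m; exact: nbhs_infty_gt.
  have mR : 0 < m%:R :> R by rewrite ltr0n.
  rewrite mE// ler_pdivrMr ?exprn_gt0// mulrAC -exprMn -natrM mulnC.
  apply: (@le_trans _ _ (ncard (thick (m * N)%:R delta (minkowski_comb l K)))%:R).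
    rewrite ler_nat; apply: up => //; rewrite natrM -mulrA.
    apply: (@le_trans _ _ (m%:R * (\sum_i l i + 1))); last by rewrite ler_wpM2l// ltW.
    rewrite mulrDr mulr1 lerD2l; near: m; exact: nbhs_infty_ger.
  apply: tP; rewrite natrM -ler_pdivrMr//; near: m; exact: nbhs_infty_ger.
rewrite distrC ler_distl; apply/andP; split.
  by rewrite ler_pdivlMr ?exprn_gt0// mulrC (le_trans _ h1)// ler_wpM2l ?exprn_ge0 ?ltW//; lra.
by rewrite ler_pdivrMr ?exprn_gt0// mulrC.
Unshelve. all: by end_near. Qed.

End MixedVolume.

(** * Existence of mixed volumes *)

Section MixedVolumeExists.
Context {R : realType} {d : nat}.

Lemma polar_mulr {e} (V : {set 'I_e} -> R) c :
  polar (fun S => V S * c) = polar V * c.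
Proof. by rewrite /polar mulr_suml; apply: eq_bigr => S _; rewrite mulrA. Qed.

(** The polarization identity for the volume, as a limit of the one for polynomials. *)
Lemma polar_Vol r (K : 'I_r -> set 'rV[R]_d) (l : 'I_r -> R) :
  (0 < d)%N -> (forall i, convex_body (K i)) -> (forall i, 0 <= l i) ->
  \sum_(phi : {ffun 'I_d -> 'I_r}) (\prod_j l (phi j)) *
    polar (fun S => Vol (minkowski_comb (fun i => (blockcount S phi i)%:R) K)) =
  d`!%:R * Vol (minkowski_comb l K).
Proof.
move=> d0 bK l0; have [P PV] := Vol_approx d0 bK.
have cl : (fun N : nat => \sum_(phi : {ffun 'I_d -> 'I_r}) (\prod_j l (phi j)) *
    polar (fun S => hom_part d (P N) (fun i => (blockcount S phi i)%:R) / N%:R ^+ d) : R) @ \oo -->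
  \sum_(phi : {ffun 'I_d -> 'I_r}) (\prod_j l (phi j)) *
    polar (fun S => Vol (minkowski_comb (fun i => (blockcount S phi i)%:R) K)).
  apply: cvg_sum_seq => phi _; apply: cvgM; first exact: cvg_cst.
  by apply: cvg_sum_seq => S _; apply: cvgM; [exact: cvg_cst | exact: PV].
have cr : (fun N : nat => d`!%:R * (hom_part d (P N) l / N%:R ^+ d) : R) @ \oo -->
    d`!%:R * Vol (minkowski_comb l K).
  by apply: cvgM; [exact: cvg_cst | exact: PV].
have E : (fun N : nat => \sum_(phi : {ffun 'I_d -> 'I_r}) (\prod_j l (phi j)) *
    polar (fun S => hom_part d (P N) (fun i => (blockcount S phi i)%:R) / N%:R ^+ d) : R) =
  (fun N : nat => d`!%:R * (hom_part d (P N) l / N%:R ^+ d) : R).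
  apply/funext => N; rewrite mulrA -polarization mulr_suml; apply: eq_bigr => phi _.
  by rewrite polar_mulr mulrA.
rewrite E in cl; exact: (cvg_unique _ cl cr).
Qed.

(** For a convex set, k K is the sum of k copies of K. *)
Lemma comb_blockcount e r (K : 'I_r -> set 'rV[R]_d) (S : {set 'I_e}) (phi : 'I_e -> 'I_r) :
  (forall i, K i !=set0) -> (forall i, convex_set (K i)) ->
  minkowski_comb (fun i => (blockcount S phi i)%:R) K =
  minkowski_comb (fun j => (j \in S)%:R) (fun j => K (phi j)).
Proof.
move=> /choice[y0 Ky0] cK.
have sumE (z : 'I_e -> 'rV[R]_d) : \sum_j (j \in S)%:R *: z j =
    \sum_i \sum_(j in [set j in S | phi j == i]) z j.
  rewrite (partition_big phi xpredT)//=; apply: eq_bigr => i _.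
  rewrite [RHS]big_mkcond [LHS]big_mkcond/=; apply: eq_bigr => j _.
  by rewrite inE; case: (j \in S); case: eqP; rewrite ?scale1r ?scale0r.
apply/seteqP; split=> x [y Ky ->].
  exists (fun j => y (phi j)) => [j|]; first exact: Ky.
  rewrite sumE; apply: eq_bigr => i _; rewrite (eq_bigr (fun=> y i)).
    by rewrite sumr_const scaler_nat.
  by move=> j; rewrite inE => /andP[_ /eqP->].
exists (fun i => if (0 < blockcount S phi i)%N then
    (blockcount S phi i)%:R^-1 *: \sum_(j in [set j in S | phi j == i]) y j else y0 i) => [i|].
  case: ifP => // bi.
  apply: (@convex_mean _ _ (K i) 'I_e (fun j => j \in [set j in S | phi j == i]) y (@cK i) bi) => j.
  by rewrite inE => /andP[_ /eqP<-].
rewrite sumE; apply: eq_bigr => i _; case: ifP => bi.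
  by rewrite scalerA mulfV ?scale1r// pnatr_eq0 -lt0n.
have b0 : blockcount S phi i = 0%N by move: bi; case: (blockcount _ _ _).
have /eqP := b0; rewrite cards_eq0 => /eqP->.
by rewrite big_set0 b0 scale0r.
Qed.

(** Polarization of the volume, the classical formula for the mixed volume. *)
Definition mixvol (K : 'I_d -> set 'rV[R]_d) : R :=
  polar (fun S : {set 'I_d} => Vol (minkowski_comb (fun j => (j \in S)%:R) K)).

Lemma mixvol_perm (K : 'I_d -> set 'rV[R]_d) (s : {perm 'I_d}) :
  (forall i, convex_body (K i)) -> mixvol (fun i => K (s i)) = mixvol K.
Proof.
move=> bK; rewrite /mixvol /polar [RHS](reindex_inj (imset_inj (@perm_inj _ s)))/=.
apply: eq_bigr => S _; congr (_ * _); last congr Vol.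
  congr (_ ^+ _); apply/eqP; rewrite -(eqn_add2l #|S|) cardsC.
  by rewrite -(card_imset S (@perm_inj _ s)) cardsC.
rewrite -(@comb_blockcount _ _ K S s) => [|i|i]; [|by have [] := bK i|by have [] := bK i].
congr minkowski_comb; apply/funext => i; congr (_%:R); rewrite /blockcount.
have [/imsetP[j jS ->]|ni] := boolP (i \in s @: S).
  rewrite -[RHS](cards1 j); apply: eq_card => k; rewrite !inE (inj_eq (@perm_inj _ s)).
  by case: eqP => [->|_]; rewrite ?jS ?andbF.
apply: eq_card0 => k; rewrite !inE; apply/negP => /andP[kS /eqP ki].
by case/negP: ni; rewrite -ki; exact: imset_f.
Qed.

Lemma content_perm r (f g : 'I_d -> 'I_r) : content f = content g ->
  exists s : {perm 'I_d}, forall j, f (s j) = g j.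
Proof.
move=> /mnmP fg.
have : perm_eq [tuple g j | j < d] [tuple f j | j < d].
  rewrite /perm_eq; apply/allP => i _; apply/eqP.
  have cE (h : 'I_d -> 'I_r) : count_mem i [tuple h j | j < d] = blockcount [set: 'I_d]%SET h i.
    rewrite /= count_map -size_filter /blockcount cardE /enum_mem; congr size.
    by rewrite -filter_predI; apply: eq_filter => j; rewrite /= !inE andbT andTb.
  by rewrite /= !cE -!contentE fg.
move=> /tuple_permP[s gs]; exists s => j.
have := congr1 (fun t => nth (g j) t j) gs.
rewrite (nth_map j) ?size_enum_ord// nth_ord_enum => ->.
by rewrite (nth_map j) ?size_enum_ord// nth_ord_enum tnth_mktuple.
Qed.

(** Group the terms of polar_Vol by the multiset of bodies involved; mixvol depends only
    on this multiset because it is symmetric. *)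
Theorem is_mixed_volume_mixvol : (0 < d)%N -> is_mixed_volume mixvol.
Proof.
move=> d0; split=> [K s bK|r K l bK l0]; first exact: mixvol_perm.
have K0 i : K i !=set0 by have [] := bK i.
have cK i : convex_set (K i) by have [] := bK i.
have fact0 : d`!%:R != 0 :> R by rewrite pnatr_eq0 -lt0n fact_gt0.
apply: (mulfI fact0); rewrite -polar_Vol//.
transitivity (\sum_(phi : {ffun 'I_d -> 'I_r})
  (fun a : multinom r => mixvol (repeat_bodies K a) * \prod_i l i ^+ a i) (content phi)).
  apply: eq_bigr => phi _ /=; rewrite prod_content mulrC; congr (_ * _).
  have [psi psic psiE] := listing (mdeg_content phi).
  have [s sE] := content_perm psic.
  have -> : repeat_bodies K (content phi) = fun j => K (psi j).
    by apply/funext => j; rewrite /repeat_bodies psiE.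
  rewrite -(@mixvol_perm (fun j => K (psi j)) s) => [|j]; last exact: bK.
  have -> : (fun j => K (psi (s j))) = fun j => K (phi j) by apply/funext => j; rewrite sE.
  by apply: eq_bigr => S _; rewrite comb_blockcount.
rewrite (@sum_content r R d (fun a => mixvol (repeat_bodies K a) * \prod_i l i ^+ a i)).
congr (_ * _); apply: eq_bigr => a _; rewrite mulrA.
by [].
Qed.

Lemma mixed_volumeP : (0 < d)%N -> is_mixed_volume (@mixed_volume R d).
Proof.
by move=> d0; rewrite /mixed_volume; apply: xgetPex; exists mixvol; exact: is_mixed_volume_mixvol.
Qed.

End MixedVolumeExists.

(** * Monomial ideals, their products and colengths *)

Section MonomialIdealTheory.
Context {k : fieldType} {d : nat}.
Implicit Types (I J : set (mpoly d k)) (M : set (multinom d)) (m : multinom d).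

Definition upset M := forall m m', M m -> (forall i, m i <= m' i)%N -> M m'.
(** The monomial ideal with the given set of exponents, when this set is upward closed. *)
Definition monomial_span M : set (mpoly d k) := [set p | forall m, m \in msupp p -> M m].
Definition exponents I : set (multinom d) := [set m | I (mpolyX k m)].

Lemma monomial_spanP M p : monomial_span M p <-> (forall m, ~ M m -> mcoeff m p = 0).
Proof.
split=> [Mp m nM|Mp m]; first by apply/eqP; rewrite mcoeff_eq0; apply/negP => /Mp.
by rewrite mcoeff_msupp; apply: contra_neqP => /Mp.
Qed.

Lemma monomial_span_X M m : monomial_span M (mpolyX k m) <-> M m.
Proof.
split=> [|Mm m']; first by apply; rewrite msuppX inE.
by rewrite msuppX inE => /eqP->.
Qed.

Lemma monomial_span_ideal M : upset M -> is_ideal (monomial_span M).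
Proof.
move=> uM; split=> [m|p q Mp Mq m /msuppD_le|a p Mp m /msuppM_le].
- by rewrite msupp0.
- by rewrite mem_cat => /orP[/Mp|/Mq].
- move=> /allpairsP[[m1 m2] /= [_ /Mp Mm2 ->]]; apply: uM Mm2 _ => i.
  by rewrite mnmDE leq_addl.
Qed.

Lemma monomial_span_sub I M : is_ideal I -> M `<=` exponents I -> monomial_span M `<=` I.
Proof.
move=> [I0 ID IM] MI p Mp; rewrite (mpolyE p) big_seq.
elim/big_ind: _ => // m mp; rewrite -mul_mpolyC; apply: IM; apply: MI; exact: Mp.
Qed.

Lemma ideal_gen_ideal (A : set (mpoly d k)) : is_ideal (ideal_gen A).
Proof.
split=> [|p q Ap Aq|a p Ap] J AJ; have [[J0 JD JM] _] := AJ.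
- exact: J0.
- by apply: JD; [exact: Ap AJ|exact: Aq AJ].
- by apply: JM; exact: Ap AJ.
Qed.

Lemma sub_ideal_gen (A : set (mpoly d k)) : A `<=` ideal_gen A.
Proof. by move=> p Ap J [_]; exact. Qed.

(** The exponents of the ideal generated by some monomials are those above one of them. *)
Lemma monomial_idealE I : monomial_ideal I ->
  upset (exponents I) /\ I = monomial_span (exponents I).
Proof.
move=> [A IA].
pose M := [set m : multinom d | exists2 a, A a & forall i, (a i <= m i)%N].
have uM : upset M.
  move=> m m' [a Aa am] mm'; exists a => // i; exact: leq_trans (am i) (mm' i).
have II : is_ideal I by rewrite IA; exact: ideal_gen_ideal.
have IM : I = monomial_span M.
  apply/seteqP; split.
    rewrite IA => p; apply; split; first exact: monomial_span_ideal.
    by move=> _ [a Aa <-]; apply/monomial_span_X; exists a => // i.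
  apply: monomial_span_sub => // m [a Aa am]; have [_ _ IM] := II.
  rewrite /exponents/= (_ : m = mnm_add (mnm_sub m a) a); last by rewrite submK//; apply/mnm_lepP.
  rewrite mpolyXD; apply: IM; rewrite IA; apply: sub_ideal_gen; by exists a.
have -> : exponents I = M.
  by rewrite IM; apply/seteqP; split=> m; rewrite /exponents/= monomial_span_X.
by [].
Qed.

Lemma ideal_mul_span M M' : upset M -> upset M' ->
  let MM := [set m | exists m1 m2, [/\ M m1, M' m2 & forall i, (m1 i + m2 i <= m i)%N]] in
  upset MM /\ ideal_mul (monomial_span M) (monomial_span M') = monomial_span MM.
Proof.
move=> uM uM' MM.
have uMM : upset MM.
  move=> m m' [m1 [m2 [M1 M2 mm]]] mm'; exists m1, m2; split=> // i.
  exact: leq_trans (mm i) (mm' i).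
split=> //; apply/seteqP; split.
  move=> x; apply; split; first exact: monomial_span_ideal.
  move=> _ [p [q [Mp Mq ->]]] m /msuppM_le /allpairsP[[m1 m2] /= [/Mp M1 /Mq M2 ->]].
  by exists m1, m2; split=> // i; rewrite mnmDE.
apply: monomial_span_sub; first exact: ideal_gen_ideal.
move=> m [m1 [m2 [M1 M2 mm]]]; rewrite /exponents/=.
have [_ _ IM] := ideal_gen_ideal [set x | exists p q, [/\ monomial_span M p, monomial_span M' q & x = p * q]].
rewrite (_ : m = mnm_add (mnm_sub m (mnm_add m1 m2)) (mnm_add m1 m2)); last first.
  by rewrite submK//; apply/mnm_lepP => i; rewrite mnmDE.
rewrite mpolyXD; apply: IM; apply: sub_ideal_gen; exists (mpolyX k m1), (mpolyX k m2).
by split; [exact/monomial_span_X|exact/monomial_span_X|rewrite mpolyXD].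
Qed.

Lemma monomial_span_setT : monomial_span setT = setT.
Proof. by apply/seteqP; split. Qed.

(** The inequality, instead of an equality, makes the formula valid also for the empty
    product, which is the whole ring. *)
Lemma ideal_prod_span r (I : 'I_r -> set (mpoly d k)) (M : 'I_r -> set (multinom d)) :
  (forall i, upset (M i)) -> (forall i, M i !=set0) -> (forall i, I i = monomial_span (M i)) ->
  let MM := [set m | exists2 q : 'I_r -> multinom d,
     forall i, M i (q i) & forall j, (\sum_i q i j <= m j)%N] in
  upset MM /\ ideal_prod I = monomial_span MM.
Proof.
move=> uM /choice[m0 Mm0] IM MM.
pose MS (s : seq 'I_r) := [set m : multinom d | exists2 q : 'I_r -> multinom d,
     forall i, M i (q i) & forall j, (\sum_(i <- s) q i j <= m j)%N].
suff H s : uniq s -> upset (MS s) /\ \big[@ideal_mul k d/setT]_(i <- s) I i = monomial_span (MS s).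
  exact: H (index_enum _) (index_enum_uniq _).
elim: s => [_|i s IHs /= /andP[ni us]].
  have -> : MS [::] = setT.
    apply/seteqP; split=> // m _; exists m0 => // j; by rewrite big_nil.
  by rewrite big_nil monomial_span_setT.
have [uMS ->{IHs}] : upset (MS s) /\ \big[@ideal_mul k d/setT]_(j <- i :: s) I j =
    ideal_mul (monomial_span (M i)) (monomial_span (MS s)).
  by rewrite big_cons IM; have [u ->] := IHs us.
have [u ->] := ideal_mul_span (uM i) uMS.
suff <- : [set m : multinom d | exists m1 m2, [/\ M i m1, MS s m2 & forall j, (m1 j + m2 j <= m j)%N]] = MS (i :: s).
  by [].
apply/seteqP; split=> m.
  move=> [m1 [m2 [M1 [q Mq qm2] mm]]].
  exists (fun j => if j == i then m1 else q j) => [j|j]; first by case: eqP => [->|].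
  rewrite big_cons eqxx (leq_trans _ (mm j))// leq_add2l (leq_trans _ (qm2 j))//.
  rewrite big_seq [leqRHS]big_seq leq_sum// => h hs.
  by case: eqP => // hi; rewrite -hi hs in ni.
move=> [q Mq qm]; exists (q i), (\big[mnm_add/mnm0]_(j <- s) q j); split=> //.
  by exists q => // j; rewrite mnm_sumE.
by move=> j; rewrite mnm_sumE; have := qm j; rewrite big_cons.
Qed.

(** Expanding each basis in the other one gives matrices with A B = 1 by uniqueness of
    coefficients; then compare ranks. *)
Lemma quotient_basis_le I N N' (b : 'I_N -> mpoly d k) (b' : 'I_N' -> mpoly d k) :
  is_ideal I -> quotient_basis I b -> quotient_basis I b' -> (N <= N')%N.
Proof.
move=> [I0 ID IM] Hb Hb'.
have /choice[A HA] : forall i, exists a : 'I_N' -> k, I (b i - \sum_j a j *: b' j).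
  by move=> i; have [a [Ia _]] := Hb' (b i); exists a.
have /choice[B HB] : forall j, exists a : 'I_N -> k, I (b' j - \sum_i a i *: b i).
  by move=> j; have [a [Ia _]] := Hb (b' j); exists a.
have IZ c p : I p -> I (c *: p) by rewrite -mul_mpolyC; exact: IM.
have Isum (J : finType) (F : J -> mpoly d k) : (forall j, I (F j)) -> I (\sum_j F j).
  by move=> IF; elim/big_ind: _.
pose Am : 'M[k]_(N, N') := \matrix_(i, j) A i j.
pose Bm : 'M[k]_(N', N) := \matrix_(j, i) B j i.
have AB : Am *m Bm = 1%:M.
  apply/matrixP => i h.
  have [a [_ au]] := Hb (b i).
  have e1 : a = fun h => (i == h)%:R.
    apply: au; rewrite (bigD1 i)//= eqxx scale1r big1 ?addr0 ?subrr// => j ji.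
    by rewrite eq_sym (negbTE ji) scale0r.
  have e2 : a = fun h => (Am *m Bm) i h.
    apply: au.
    have -> : b i - \sum_h (Am *m Bm) i h *: b h = (b i - \sum_j A i j *: b' j) +
        \sum_j A i j *: (b' j - \sum_h B j h *: b h).
      rewrite [X in _ = _ + X](eq_bigr (fun j => A i j *: b' j - \sum_h (A i j * B j h) *: b h)); last first.
        by move=> j _; rewrite scalerBr scaler_sumr; congr (_ - _); apply: eq_bigr => h' _; rewrite scalerA.
      rewrite sumrB addrA subrK; congr (_ - _); rewrite exchange_big; apply: eq_bigr => h' _.
      by rewrite mxE scaler_suml; apply: eq_bigr => j _; rewrite !mxE.
    by apply: ID; [exact: HA|apply: Isum => j; apply: IZ; exact: HB].
  rewrite [RHS]mxE; have := congr1 (fun f => f h) e1; rewrite e2 => ->.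
  by [].
by have := mulmx_max_rank Am Bm; rewrite AB mxrank1.
Qed.

(** The monomials outside the ideal form a basis of the quotient. *)
Lemma quotient_dim_span M : upset M -> finite_set (~` M) ->
  quotient_dim (monomial_span M) = ncard (~` M).
Proof.
move=> uM fM; pose s := enum_fset (fset_set (~` M)).
have sP m : m \in s <-> ~ M m.
  rewrite in_fset_set//; split=> [/set_mem//|nM]; exact/mem_set.
have us : uniq s by exact: fset_uniq.
have Hs : quotient_basis (monomial_span M) (fun i : 'I_(size s) => mpolyX k (nth mnm0 s i)).
  move=> p.
  have cE (a : 'I_(size s) -> k) (i : 'I_(size s)) :
      mcoeff (nth mnm0 s i) (\sum_j a j *: mpolyX k (nth mnm0 s j)) = a i.
    rewrite raddf_sum/= (bigD1 i)//= mcoeffZ mcoeffX eqxx mulr1 big1 ?addr0// => j ji.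
    by rewrite mcoeffZ mcoeffX nth_uniq// val_eqE (negbTE ji) mulr0.
  exists (fun i => mcoeff (nth mnm0 s i) p); split.
    apply/monomial_spanP => m /sP ms; have ims : (index m s < size s)%N by rewrite index_mem.
    have <- : nth mnm0 s (Ordinal ims) = m by rewrite nth_index.
    by rewrite mcoeffB cE subrr.
  move=> a /monomial_spanP Ha; apply/funext => i.
  have := Ha (nth mnm0 s i) (iffLR (sP _) (mem_nth _ (ltn_ord i))).
  by rewrite mcoeffB cE => /subr0_eq.
have [b Hb] : exists b : 'I_(quotient_dim (monomial_span M)) -> mpoly d k, quotient_basis (monomial_span M) b.
  rewrite /quotient_dim; case: xgetP => [N _ [b Hb]|/(_ (size s))]; first by exists b.
  by case; exists (fun i : 'I_(size s) => mpolyX k (nth mnm0 s i)).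
have II := monomial_span_ideal uM.
by apply/eqP; rewrite eqn_leq (quotient_basis_le II Hb Hs) (quotient_basis_le II Hs Hb).
Qed.

End MonomialIdealTheory.

(** * Newton-Okounkov bodies of graded families of exponents *)

Section NewtonOkounkov.
Context {R : realType} {d : nat}.

Lemma norm_conv_lt (t u v e : R) : 0 <= t -> t <= 1 -> `|u| < e -> `|v| < e ->
  `|t * u + (1 - t) * v| < e.
Proof.
move=> t0 t1 ue ve; have t1' : 0 <= 1 - t by rewrite subr_ge0.
pose M := Num.max `|u| `|v|.
apply: (@le_lt_trans _ _ M); last by rewrite /M gt_max ue.
rewrite (le_trans (ler_normD _ _))// !normrM (ger0_norm t0) (ger0_norm t1').
have -> : M = t * M + (1 - t) * M by ring.
by rewrite lerD// ler_wpM2l// /M le_max lexx ?orbT.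
Qed.

Lemma closureP_coord (A : set ('rV[R]_d * R)) x s : closure A (x, s) <->
  forall e, 0 < e -> exists x' s', [/\ A (x', s'), forall j, `|x 0 j - x' 0 j| < e & `|s - s'| < e].
Proof.
split=> [cA e e0|H B /nbhs_ballP[e /= e0 eB]].
  have [] := cA (ball (x, s) e); first by apply/nbhs_ballP; exists e.
  move=> [x' s'] [Axs [[_ xx'] ss']]; exists x', s'; split=> // j.
  exact: xx'.
have [x' [s' [Axs xx' ss']]] := H e e0.
exists (x', s'); split=> //; apply: eB; split=> //; split=> // i j.
by rewrite (ord1 i); exact: xx'.
Qed.

Lemma cone_scale (A : set ('rV[R]_d * R)) t p : 0 <= t -> convex_cone A p -> convex_cone A (t *: p).
Proof.
move=> t0 [N [a [s [as0 ->]]]]; exists N, (fun i => t * a i), s; split.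
  by move=> i; have [a0 As] := as0 i; rewrite mulr_ge0.
by rewrite scaler_sumr; apply: eq_bigr => i _; rewrite scalerA.
Qed.

Lemma cone_add (A : set ('rV[R]_d * R)) p q : convex_cone A p -> convex_cone A q -> convex_cone A (p + q).
Proof.
move=> [N [a [s [as0 ->]]]] [N' [a' [s' [as0' ->]]]].
exists (N + N')%N, (fun i => match fintype.split i with inl j => a j | inr j => a' j end),
  (fun i => match fintype.split i with inl j => s j | inr j => s' j end).
split=> [i|]; first by case: (fintype.split i).
rewrite big_split_ord/=; congr (_ + _); apply: eq_bigr => i _.
  by rewrite (unsplitK (inl i : 'I_N + 'I_N')).
by rewrite (unsplitK (inr i : 'I_N + 'I_N')).
Qed.

Variables (c : nat) (E : nat -> set (multinom d)).
Hypotheses (d0 : (0 < d)%N) (c1 : (1 <= c)%N).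
Hypothesis uE : forall n, upset (E n).
Hypothesis E0 : E 0%N = setT.
Hypothesis ED : forall a b m1 m2, E a m1 -> E b m2 -> E (a + b)%N (mnm_add m1 m2).
Hypothesis Edeg : forall n m, (c.-1 * n <= mdeg m)%N -> E n m.

(** The semigroup Gamma_(e_i), with the i-th family given by its exponents E n. *)
Definition bounded_semigroup : set (multinom d * nat) :=
  [set q | E q.2 q.1 /\ (mdeg q.1 <= c * q.2)%N].
Local Notation S := bounded_semigroup.
Local Notation D := (@Delta R d S).

Lemma coneP_coord x s : convex_cone [set embed_point R q | q in S] (x, s) <->
  exists N (a : 'I_N -> R) (p : 'I_N -> multinom d) (k : 'I_N -> nat),
    [/\ forall i, 0 <= a i, forall i, S (p i, k i),
        forall j, x 0 j = \sum_i a i * (p i j)%:R & s = \sum_i a i * (k i)%:R].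
Proof.
split.
  move=> [N [a [t [at0 E1]]]].
  have /choice[q qP] : forall i, exists q, S q /\ embed_point R q = t i.
    by move=> i; have [_ [q Sq qt]] := at0 i; exists q.
  exists N, a, (fun i => (q i).1), (fun i => (q i).2); split.
  - by move=> i; have [] := at0 i.
  - by move=> i; have [] := qP i; case: (q i).
  - move=> j; have -> : x = \sum_i a i *: (t i).1.
      have := congr1 fst E1; rewrite /= => ->.
      by rewrite (raddf_sum fst).
    rewrite summxE; apply: eq_bigr => i _; have [_ <-] := qP i.
    by rewrite !mxE.
  - have -> : s = \sum_i a i *: (t i).2.
      have := congr1 snd E1; rewrite /= => ->.
      by rewrite (raddf_sum snd).
    by apply: eq_bigr => i _; have [_ <-] := qP i.
move=> [N [a [p [k [a0 Sp xE sE]]]]].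
exists N, a, (fun i => embed_point R (p i, k i)); split.
  by move=> i; split=> //; exists (p i, k i).
rewrite [RHS]surjective_pairing (raddf_sum fst) (raddf_sum snd)/=; congr (_, _) => //.
by apply/rowP => j; rewrite xE summxE; apply: eq_bigr => i _; rewrite !mxE.
Qed.

(** Membership in the Newton-Okounkov body in coordinates: closeness to conical
    combinations of points of the semigroup. *)
Lemma DeltaP y : D y <-> forall e, 0 < e ->
  exists N (a : 'I_N -> R) (p : 'I_N -> multinom d) (k : 'I_N -> nat),
    [/\ forall i, 0 <= a i, forall i, S (p i, k i),
        forall j, `|y 0 j - \sum_i a i * (p i j)%:R| < e & `|1 - \sum_i a i * (k i)%:R| < e].
Proof.
rewrite /Delta/Con/=; split.
  move=> /closureP_coord H e e0; have [x' [s' [/coneP_coord[N [a [p [k [a0 Sp xE sE]]]]] h1 h2]]] := H e e0.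
  exists N, a, p, k; split=> //; first by move=> j; rewrite -xE.
  by rewrite -sE.
move=> H; apply/closureP_coord => e e0; have [N [a [p [k [a0 Sp h1 h2]]]]] := H e e0.
exists (\row_j \sum_i a i * (p i j)%:R), (\sum_i a i * (k i)%:R); split=> //.
  apply/coneP_coord; exists N, a, p, k; split=> // j; by rewrite mxE.
by move=> j; rewrite mxE.
Qed.

Lemma Delta_quotient p k : S (p, k) -> (0 < k)%N -> D (\row_j ((p j)%:R / k%:R)).
Proof.
move=> Sp k0; apply/DeltaP => e e0.
exists 1%N, (fun=> k%:R^-1), (fun=> p), (fun=> k); split=> // [j|].
  by rewrite big_ord1 mxE mulrC subrr normr0.
by rewrite big_ord1 mulVf ?subrr ?normr0// pnatr_eq0 -lt0n.
Qed.

Lemma Delta_bounds y : D y -> (forall j, 0 <= y 0 j) /\ \sum_j y 0 j <= c%:R.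
Proof.
move=> /DeltaP Dy; split=> [j|].
  rewrite leNgt; apply/negP => yj.
  have [|N [a [p [k [a0 Sp h1 _]]]]] := Dy (- y 0 j); first by rewrite oppr_gt0.
  have s0 : 0 <= \sum_i a i * (p i j)%:R by apply: sumr_ge0 => i _; rewrite mulr_ge0.
  by have := h1 j; rewrite ltr_norml => /andP[h2 _]; lra.
apply/ler_addgt0Pr => e e0.
pose e' := e / (d + c)%:R.
have dc0 : 0 < (d + c)%:R :> R by rewrite ltr0n addn_gt0 d0.
have e'0 : 0 < e' by rewrite divr_gt0.
have [N [a [p [k [a0 Sp h1 h2]]]]] := Dy e' e'0.
have : \sum_j y 0 j <= \sum_(j < d) (\sum_i a i * (p i j)%:R + e').
  by apply: ler_sum => j _; have := h1 j; rewrite ltr_norml => /andP[_ h3]; lra.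
move=> /le_trans; apply; rewrite big_split/= sumr_const card_ord exchange_big/=.
have h4 : \sum_i \sum_(j < d) a i * (p i j)%:R <= c%:R * \sum_i a i * (k i)%:R.
  rewrite mulr_sumr; apply: ler_sum => i _; rewrite -mulr_sumr mulrCA ler_wpM2l// -natrM.
  by rewrite -natr_sum ler_nat -mdegE; have [] := Sp i.
have h5 : c%:R * \sum_i a i * (k i)%:R <= c%:R * (1 + e').
  by rewrite ler_wpM2l//; move: h2; rewrite ltr_norml => /andP[h2 _]; lra.
have h6 : e = d%:R * e' + c%:R * e' by rewrite -mulrDl -natrD /e' mulrC divfK// gt_eqF.
by rewrite -mulr_natl; lra.
Qed.

Lemma Delta_bounded : bounded_by c%:R D.
Proof.
move=> y /Delta_bounds[y0 ys] j; rewrite ger0_norm//; apply: le_trans ys.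
by rewrite (bigD1 j)//= lerDl sumr_ge0.
Qed.

Lemma Delta_convex_body : convex_body D.
Proof.
split.
- have m1 : (c.-1 * 1 <= mdeg (Multinom [tuple (if j == Ordinal d0 then c.-1 else 0%N) | j < d]))%N.
    by rewrite muln1 mdegE (bigD1 (Ordinal d0))//= mnmE eqxx leq_addr.
  eexists; apply: (@Delta_quotient (Multinom [tuple (if j == Ordinal d0 then c.-1 else 0%N) | j < d]) 1) => //.
  split; first exact: Edeg.
  rewrite mdegE (bigD1 (Ordinal d0))//= mnmE eqxx big1 ?addn0 ?muln1 ?leq_pred// => j /negbTE jn.
  by rewrite mnmE jn.
- have cD : closed D.
    move=> y cy; apply/DeltaP => e e0; have e20 : 0 < e / 2 by rewrite divr_gt0.
    have [|y' [Dy' [_ yy']]] := cy (ball y (e / 2)); first by apply/nbhs_ballP; exists (e / 2).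
    have [N [a [p [k [a0 Sp h1 h2]]]]] := (DeltaP y').1 Dy' _ e20.
    exists N, a, p, k; split=> // [j|]; last by apply: lt_trans h2 _; lra.
    have : `|y 0 j - y' 0 j| < e / 2 := yy' 0 j.
    by have := h1 j; rewrite !ltr_norml => /andP[? ?] /andP[? ?]; apply/andP; split; lra.
  have cB : compact [set v : 'rV[R]_d | forall i, v ord0 i \in `[- c%:R, c%:R]].
    apply: (@rV_compact _ _ (fun=> `[(- c%:R : R), c%:R]%classic)).
    by move=> _; exact: segment_compact.
  apply: subclosed_compact cD cB _ => y Dy j.
  by rewrite in_itv/= -ler_norml; exact: Delta_bounded.
- apply/convex_setP => x y t t0 t1 /closureP_coord Dx /closureP_coord Dy.
  apply/closureP_coord => e e0.
  have [x' [s [Cx xx' ss]]] := Dx e e0; have [y' [s' [Cy yy' ss']]] := Dy e e0.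
  exists (t *: x' + (1 - t) *: y'), (t * s + (1 - t) * s'); split.
  + have := cone_add (cone_scale t0 Cx) (cone_scale (_ : 0 <= 1 - t) Cy).
    by apply; rewrite subr_ge0.
  + move=> j; rewrite !mxE.
    have -> : t * x 0 j + (1 - t) * y 0 j - (t * x' 0 j + (1 - t) * y' 0 j) =
      t * (x 0 j - x' 0 j) + (1 - t) * (y 0 j - y' 0 j) by ring.
    exact: norm_conv_lt.
  + have -> : 1 - (t * s + (1 - t) * s') = t * (1 - s) + (1 - t) * (1 - s') by ring.
    exact: norm_conv_lt.
Qed.

Lemma semigroup_comb N (b : 'I_N -> nat) (p : 'I_N -> multinom d) (k : 'I_N -> nat) :
  (forall i, E (k i) (p i)) ->
  E (\sum_i b i * k i)%N (\big[mnm_add/mnm0]_i mnm_muln (p i) (b i)).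
Proof.
move=> Ep; elim/big_ind2: _ => [|a m1 b' m2|i _]; [by rewrite E0|exact: ED|].
elim: (b i) => [|n IHn]; first by rewrite mul0n E0.
by rewrite mulSn mulmS; exact: ED.
Qed.

(** Approximate y by a conical combination of semigroup elements (p_i, k_i), multiply its
    coefficients by m (1 - e) for a small e and round them down. This gives an exponent
    P of E k' with k' slightly below m, and P at most slightly above m y. Since the family need not be
    decreasing, the difference m - k' is filled by a pure power Q of one variable, of
    degree proportional to m - k'. *)
Lemma Delta_above y eta : D y -> 0 < eta ->
  exists T : nat, forall m (p : multinom d), (T <= m)%N ->
    (forall j, m%:R * (y 0 j + eta) <= (p j)%:R) -> E m p.
Proof.
move=> Dy eta0; have /DeltaP H := Dy.
(* With this e, the errors m e of P and 2 c m e of Q leave room for the bounded error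
   c kappa, which is at most m eta / 2 by the choice of the threshold. *)
pose e := Num.min (1 / 2) (eta / (8 * c)%:R).
have c0 : 0 < c%:R :> R by rewrite ltr0n.
have e0 : 0 < e by rewrite /e lt_min divr_gt0//= divr_gt0// natrM mulr_gt0.
have e1 : e <= 1 / 2 by rewrite /e ge_min lexx.
have ec : 8 * (c%:R * e) <= eta.
  have : e <= eta / (8 * c)%:R by rewrite /e ge_min lexx orbT.
  rewrite ler_pdivlMr ?natrM ?mulr_gt0//; lra.
have [N [a [p0 [k [a0 Sp h1 h2]]]]] := H e e0.
pose kappa := (\sum_i k i)%N.
exists (Num.truncn (2 * (c%:R * kappa%:R) / eta)).+1 => m p Tm pm.
have mR : 2 * (c%:R * kappa%:R) <= m%:R * eta.
  rewrite -ler_pdivrMr//; apply/ltW/(lt_le_trans (truncnS_gt _)).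
  by rewrite ler_nat.
pose b i := Num.truncn (m%:R * (1 - e) * a i).
have ma0 i : 0 <= m%:R * (1 - e) * a i by rewrite !mulr_ge0// subr_ge0; lra.
have bP i : (b i)%:R <= m%:R * (1 - e) * a i < (b i).+1%:R by exact: truncn_itv.
pose k' := (\sum_i b i * k i)%N.
have sk : 1 - e <= \sum_i a i * (k i)%:R <= 1 + e.
  by move: h2; rewrite ltr_norml => /andP[h3 h4]; apply/andP; split; lra.
have m0 : 0 <= m%:R :> R by [].
have k'le : k'%:R <= m%:R * ((1 - e) * (1 + e)).
  rewrite /k' natr_sum; apply: (@le_trans _ _ (m%:R * (1 - e) * \sum_i a i * (k i)%:R)).
    rewrite mulr_sumr; apply: ler_sum => i _; rewrite natrM mulrA ler_wpM2r//.
    by have /andP[] := bP i.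
  rewrite -mulrA ler_wpM2l// ler_wpM2l//; [lra|by have /andP[] := sk].
have k'm : (k' <= m)%N.
  rewrite -(ler_nat R); apply: (le_trans k'le); rewrite -[leRHS]mulr1 ler_wpM2l//; nra.
have k'ge : m%:R * (1 - 2 * e) - kappa%:R <= k'%:R.
  apply: (@le_trans _ _ (\sum_i (m%:R * (1 - e) * a i - 1) * (k i)%:R)); last first.
    rewrite /k' natr_sum; apply: ler_sum => i _; rewrite natrM ler_wpM2r//.
    by have /andP[_] := bP i; rewrite -natr1; lra.
  have -> : \sum_i (m%:R * (1 - e) * a i - 1) * (k i)%:R =
      m%:R * (1 - e) * (\sum_i a i * (k i)%:R) - kappa%:R.
    rewrite /kappa natr_sum mulr_sumr -sumrB; apply: eq_bigr => i _; ring.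
  rewrite lerD2r -mulrA ler_wpM2l//.
  by have /andP[h3 _] := sk; nra.
pose P := \big[mnm_add/mnm0]_i mnm_muln (p0 i) (b i).
have EP : E k' P by apply: semigroup_comb => i; have [] := Sp i.
have PE j : (P j)%:R <= m%:R * (y 0 j + e).
  have -> : P j = (\sum_i b i * p0 i j)%N.
    by rewrite /P mnm_sumE; apply: eq_bigr => i _; rewrite mulmnE mulnC.
  rewrite natr_sum; apply: (@le_trans _ _ (m%:R * \sum_i a i * (p0 i j)%:R)).
    rewrite mulr_sumr; apply: ler_sum => i _; rewrite natrM mulrA ler_wpM2r//.
    have /andP[h3 _] := bP i; apply: (le_trans h3); rewrite -mulrA ler_wpM2l//.
    by have := a0 i; nra.
  by rewrite ler_wpM2l//; have := h1 j; rewrite ltr_norml => /andP[h3 _]; lra.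
pose Q := mnm_muln (mnm1 (Ordinal d0)) (c.-1 * (m - k'))%N.
have EQ : E (m - k')%N Q by apply: Edeg; rewrite mdegMn mdeg1 mul1n.
have Em : E m (mnm_add P Q) by rewrite -[m](subnKC k'm); exact: ED.
apply: uE Em _ => j; rewrite mnmDE -(ler_nat R) natrD.
apply: le_trans (pm j).
have Qj : (Q j)%:R <= c%:R * (m%:R * (2 * e) + kappa%:R).
  apply: (@le_trans _ _ (c * (m - k'))%N%:R).
    rewrite ler_nat mulmnE mnm1E; apply: (@leq_trans (c.-1 * (m - k'))%N).
      by case: eqP => _; rewrite ?mul1n ?mul0n.
    by rewrite leq_mul2r leq_pred orbT.
  by rewrite natrM ler_wpM2l ?(ltW c0)// natrB//; lra.
have := PE j; have : e <= c%:R * e by rewrite ler_peMl ?(ltW e0)// ler1n.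
move=> ce PEj; apply: (le_trans (lerD PEj Qj)).
have h3 : m%:R * (8 * (c%:R * e)) <= m%:R * eta by rewrite ler_wpM2l.
have h4 : m%:R * e <= m%:R * (c%:R * e) by rewrite ler_wpM2l.
have h5 : m%:R * e + c%:R * (m%:R * (2 * e) + kappa%:R) <= m%:R * eta.
  have : 0 <= m%:R * (c%:R * e) by rewrite !mulr_ge0// ltW.
  lra.
lra.
Qed.

(** Points of the body with the same integer part of M y are close to each other, and
    there are finitely many such integer parts, so one threshold serves all points. *)
Lemma Delta_above_uniform eta : 0 < eta ->
  exists T : nat, forall m (p : multinom d) y, (T <= m)%N -> D y ->
    (forall j, m%:R * (y 0 j + eta) <= (p j)%:R) -> E m p.
Proof.
move=> eta0; have e20 : 0 < eta / 2 by rewrite divr_gt0.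
pose M := (Num.truncn (2 / eta)).+1.
have M0 : 0 < M%:R :> R by rewrite ltr0n.
have Meta : 1 <= M%:R * (eta / 2).
  have : 2 / eta < M%:R by exact: truncnS_gt.
  by rewrite ltr_pdivrMr//; lra.
clearbody M.
have /choice[T TP] : forall f : 'rV[int]_d, exists T : nat, forall m (p : multinom d) y,
    (T <= m)%N -> D y -> floor_vec (M%:R *: y) = f ->
    (forall j, m%:R * (y 0 j + eta) <= (p j)%:R) -> E m p.
  move=> f; have [[y0 [Dy0 fy0]]|nf] := pselect (exists y, D y /\ floor_vec (M%:R *: y) = f); last first.
    by exists 0%N => m p y _ Dy fy; case: nf; exists y.
  have [T TP] := Delta_above Dy0 e20; exists T => m p y Tm Dy fy pm.
  apply: (TP m p Tm) => j; apply: le_trans (pm j); rewrite ler_wpM2l//.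
  have : Num.floor (M%:R * y 0 j) = Num.floor (M%:R * y0 0 j).
    by have /rowP/(_ j) := etrans fy (esym fy0); rewrite !mxE.
  move=> fl; have /andP[_ h1] := floor_itv (M%:R * y 0 j).
  have /andP[h2 h3] := floor_itv (M%:R * y0 0 j); have /andP[h4 _] := floor_itv (M%:R * y 0 j).
  rewrite fl in h4; rewrite intrD in h3.
  by rewrite -(ler_pM2l M0) !mulrDr; lra.
pose Ts := enum_fset (fset_set (floors M%:R D)).
exists (\max_(f <- Ts) T f)%N => m p y Tm Dy pm.
have fT : floor_vec (M%:R *: y) \in Ts.
  rewrite in_fset_set; first by apply/mem_set; exists y.
  exact: finite_floors Delta_bounded.
apply: (TP (floor_vec (M%:R *: y)) m p y _ Dy erefl pm); apply: leq_trans Tm.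
by rewrite (big_rem _ fT)/= leq_max leqnn.
Qed.

End NewtonOkounkov.

(** * Splitting and counting exponents *)

Section ExponentSplitting.
Context {d : nat}.
Implicit Types m : multinom d.

Lemma exists_sub_degree m w : (w <= mdeg m)%N ->
  exists2 m1 : multinom d, forall j, (m1 j <= m j)%N & mdeg m1 = w.
Proof.
rewrite mdegE => /exists_split[f fm fw]; exists (Multinom [tuple f j | j < d]).
  by move=> j; rewrite mnmE.
by rewrite mdegE -fw; apply: eq_bigr => j _; rewrite mnmE.
Qed.

Lemma exists_split_degrees (I : eqType) (s : seq I) (w : I -> nat) m : uniq s ->
  (\sum_(i <- s) w i <= mdeg m)%N ->
  exists2 q : I -> multinom d, forall i, i \in s -> mdeg (q i) = w i &
    forall j, (\sum_(i <- s) q i j <= m j)%N.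
Proof.
elim: s m => [|i s IHs] m /=.
  by move=> _ _; exists (fun=> mnm0) => // j; rewrite big_nil.
move=> /andP[ni us]; rewrite big_cons => wm.
have [m1 m1m m1w] := exists_sub_degree (leq_trans (leq_addr _ _) wm).
have mE : m = mnm_add (mnm_sub m m1) m1 by rewrite submK//; apply/mnm_lepP.
have [|q qw qm] := IHs (mnm_sub m m1) us.
  by move: wm; rewrite {1}mE mdegD m1w addnC leq_add2r.
exists (fun h => if h == i then m1 else q h) => [h|j].
  by rewrite inE; case: eqP => [-> _//|_ /= hs]; exact: qw.
rewrite big_cons eqxx {1}mE mnmDE addnC leq_add2r (leq_trans _ (qm j))//.
rewrite big_seq [leqRHS]big_seq leq_sum// => h hs.
by case: eqP => // hi; rewrite -hi hs in ni.
Qed.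

(** While some q i exceeds its capacity C i, another one is below its own; moving one
    variable from the former to the latter keeps both good, because exponents of degree
    at least C i are always good. *)
Lemma redistribute (r : nat) (good : 'I_r -> set (multinom d)) (C : 'I_r -> nat)
    (q : 'I_r -> multinom d) :
  (forall i, upset (good i)) -> (forall i m, (C i <= mdeg m)%N -> good i m) ->
  (forall i, good i (q i)) -> (\sum_i mdeg (q i) <= \sum_i C i)%N ->
  exists q' : 'I_r -> multinom d, [/\ forall i, good i (q' i),
    forall i, (mdeg (q' i) <= C i)%N & forall j, (\sum_i q' i j = \sum_i q i j)%N].
Proof.
move=> ug gC; have [e] := ubnP (\sum_i (mdeg (q i) - C i))%N.
elim: e q => // e IHe q qe gq qC.
have [/forallP qle|] := boolP [forall i, (mdeg (q i) <= C i)%N]; first by exists q.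
rewrite negb_forall => /existsP[i]; rewrite -ltnNge => Ci.
have [i' Ci'] : exists i', (mdeg (q i') < C i')%N.
  apply/existsP; apply: contraTT qC; rewrite negb_exists => /forallP H.
  rewrite -ltnNge (bigD1 i)//= [ltnRHS](bigD1 i)//= -addSn leq_add// leq_sum// => h _.
  by have := H h; rewrite -leqNgt.
have ii' : i != i' by apply: contraTneq Ci => ->; rewrite -leqNgt ltnW.
have [t qt] : exists t, (0 < q i t)%N.
  apply/existsP; apply: contraTT Ci; rewrite negb_exists => /forallP H.
  rewrite -leqNgt mdegE big1// => t _; by have := H t; rewrite -eqn0Ngt => /eqP.
pose qi := mnm_sub (q i) (mnm1 t).
have qiE : q i = mnm_add qi (mnm1 t).
  by rewrite submK//; apply/mnm_lepP => j; rewrite mnm1E; case: eqP => // <-.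
have dqi : mdeg (q i) = (mdeg qi).+1 by rewrite {1}qiE mdegD mdeg1 addn1.
(* One variable, of index t, moves from the part i to the part i'. *)
pose q1 h := if h == i then qi else if h == i' then mnm_add (q i') (mnm1 t) else q h.
have q1i : q1 i = qi by rewrite /q1 eqxx.
have q1i' : q1 i' = mnm_add (q i') (mnm1 t) by rewrite /q1 eq_sym (negbTE ii') eqxx.
have q1h h : h != i -> h != i' -> q1 h = q h by rewrite /q1 => /negbTE-> /negbTE->.
have ii2 : i' != i by rewrite eq_sym.
have sumE (F : 'I_r -> nat) : (\sum_h F h = F i + (F i' + \sum_(h | (h != i) && (h != i')) F h))%N.
  by rewrite (bigD1 i)//= (bigD1 i').
have q1C : (\sum_h (mdeg (q1 h) - C h) < e)%N.
  have : (\sum_h (mdeg (q1 h) - C h) < \sum_h (mdeg (q h) - C h))%N.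
    rewrite !sumE q1i q1i' mdegD mdeg1 addn1 dqi.
    rewrite (eq_bigr (fun h => mdeg (q h) - C h)%N); last by move=> h /andP[h1 h2]; rewrite q1h.
    set S := (\sum_(h | _) _)%N; move: Ci Ci'; rewrite dqi; lia.
  by move=> /leq_trans; apply; rewrite -ltnS.
have sumq1 j : (\sum_h q1 h j = \sum_h q h j)%N.
  rewrite !sumE q1i q1i' (eq_bigr (fun h => q h j)); last by move=> h /andP[h1 h2]; rewrite q1h.
  by rewrite [in RHS]qiE !mnmDE; set S := (\sum_(h | _) _)%N; lia.
have [h||q' [g' C' s']] := IHe q1 q1C.
- have [->|hi] := eqVneq h i; first by rewrite q1i; apply: gC; move: Ci; rewrite dqi.
  have [->|hi'] := eqVneq h i'; last by rewrite q1h.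
  by rewrite q1i'; apply: ug (gq i') _ => j; rewrite mnmDE leq_addr.
- apply: leq_trans qC; rewrite leq_eqVlt; apply/orP; left; apply/eqP.
  under eq_bigr do rewrite mdegE; rewrite exchange_big.
  under [RHS]eq_bigr do rewrite mdegE; rewrite [RHS]exchange_big.
  by apply: eq_bigr => j _; exact: sumq1.
by exists q'; split=> // j; rewrite s' sumq1.
Qed.

Lemma ncard_simplex s : finite_set [set p : multinom d | (mdeg p <= s)%N] /\
  ncard [set p : multinom d | (mdeg p <= s)%N] = 'C(d + s, d).
Proof.
pose f (t : d.-tuple 'I_s.+1) : multinom d := Multinom [tuple (tnth t j : nat) | j < d].
pose P := fun t : d.-tuple 'I_s.+1 => (\sum_(i <- t) i <= s)%N.
have E : [set p : multinom d | (mdeg p <= s)%N] = f @` [set t | P t].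
  have fd t : mdeg (f t) = (\sum_(i <- t) i)%N.
    by rewrite mdegE big_tuple; apply: eq_bigr => j _; rewrite mnmE.
  apply/seteqP; split=> p /=; last by move=> [t Pt <-]; rewrite fd.
  move=> ps; have pj j : (p j < s.+1)%N.
    by rewrite ltnS (leq_trans _ ps)// mdegE (bigD1 j)//= leq_addr.
  have fE : f [tuple Ordinal (pj j) | j < d] = p.
    by apply/mnmP => j; rewrite mnmE tnth_mktuple.
  by exists [tuple Ordinal (pj j) | j < d]; rewrite // /P -fd fE.
have fT : finite_set [set t | P t] by exact: finite_finset.
split; first by rewrite E; exact: finite_image.
rewrite E ncard_inj//.
  by rewrite ncard_fin -card_partial_ord_partitions; apply: eq_card => t; rewrite inE.
move=> t u _ _ /mnmP tu; apply: eq_from_tnth => j; apply: val_inj.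
by have := tu j; rewrite !mnmE.
Qed.

Lemma bin_bounds (R : realType) s :
  (s%:R ^+ d <= d`!%:R * 'C(d + s, d)%:R :> R) /\
  (d`!%:R * 'C(d + s, d)%:R <= (s + d)%:R ^+ d :> R).
Proof.
rewrite -natrM mulnC bin_ffact ffact_prod natr_prod.
have cE (x : R) : x ^+ d = \prod_(i < d) x by rewrite prodr_const card_ord.
rewrite !cE; split; apply: ler_prod => i _; rewrite ler0n ler_nat/=.
  by have := ltn_ord i; lia.
by lia.
Qed.

End ExponentSplitting.

(** * Graded families of monomial ideals *)

Section GradedFamilies.
Context {k : fieldType} {d : nat}.

Lemma monomial_max_ideal : monomial_ideal (max_ideal k d).
Proof.
exists (range mnm1); congr ideal_gen; apply/seteqP; split=> p.
  by move=> [i _ <-]; exists (mnm1 i).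
by move=> [_ [i _ <-] <-]; exists i.
Qed.

(** An exponent of degree s is a sum of s basis vectors. *)
Lemma ideal_exp_max_ideal s (m : multinom d) :
  (s <= mdeg m)%N -> ideal_exp (max_ideal k d) s (mpolyX k m).
Proof.
move=> /exists_sub_degree[m1 m1m m1s].
have [um Em] := monomial_idealE monomial_max_ideal.
have m0 : exponents (max_ideal k d) !=set0 \/ (s = 0)%N.
  case: s m1s => [|s]; first by right.
  move=> m1s; left; have : (0 < mdeg m1)%N by rewrite m1s.
  rewrite lt0n mdeg_eq0 => /eqP m10.
  have [i _] : exists i : 'I_d, (0 < m1 i)%N.
    have [/existsP//|] := boolP [exists i : 'I_d, (0 < m1 i)%N].
    rewrite negb_exists => /forallP H; case: m10.
    by apply/mnmP => i; rewrite mnm0E; have := H i; rewrite -eqn0Ngt => /eqP.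
  by exists (mnm1 i); apply: sub_ideal_gen; exists i.
case: m0 => [m0|s0]; last first.
  by rewrite s0 /ideal_exp /ideal_prod big_ord0.
rewrite /ideal_exp; have [_ ->] := @ideal_prod_span k d s (fun=> max_ideal k d) (fun=> exponents (max_ideal k d))
  (fun=> um) (fun=> m0) (fun=> Em).
apply/monomial_span_X; have [f fm1 _] := listing m1s.
exists (fun u => mnm1 (f u)) => [u|j].
  by apply: sub_ideal_gen; exists (f u).
apply: leq_trans (m1m j); rewrite -fm1 contentE /blockcount -sum1_card big_mkcond/=.
rewrite [leqRHS]big_mkcond/= leq_sum// => u _.
by rewrite mnm1E inE; case: eqP => //; rewrite inE.
Qed.

Variables (c : nat) (J : nat -> set (mpoly d k)).
Hypotheses (gJ : graded_family J) (c2 : (2 <= c)%N).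
Hypothesis Jc : ideal_exp (max_ideal k d) (c - 1)%N `<=` J 1%N.

Local Notation E := (fun n => exponents (J n)).

Lemma family_upset n : upset (E n).
Proof. by have [_ mJ _ _] := gJ; have [] := monomial_idealE (mJ n). Qed.

Lemma family_span n : J n = monomial_span (E n).
Proof. by have [_ mJ _ _] := gJ; have [] := monomial_idealE (mJ n). Qed.

Lemma family0 : E 0%N = setT.
Proof. by have [J0 _ _ _] := gJ; rewrite J0; apply/seteqP; split. Qed.

Lemma familyD a b m1 m2 : E a m1 -> E b m2 -> E (a + b)%N (mnm_add m1 m2).
Proof.
move=> E1 E2; have [_ _ JD _] := gJ; apply: JD; apply: sub_ideal_gen.
by exists (mpolyX k m1), (mpolyX k m2); split=> //; rewrite mpolyXD.
Qed.

(** Split off an exponent of degree (c-1) n and use multiplicativity of the family. *)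
Lemma family_deg n m : (c.-1 * n <= mdeg m)%N -> E n m.
Proof.
have E1 m' : (c.-1 <= mdeg m')%N -> E 1%N m'.
  by move=> cm; apply: Jc; apply: ideal_exp_max_ideal; rewrite subn1.
elim: n m => [|n IHn] m cm; first by rewrite family0.
have [|m1 m1m m1s] := @exists_sub_degree d m (c.-1 * n); first by rewrite (leq_trans _ cm)// leq_mul.
have mE : m = mnm_add (mnm_sub m m1) m1 by rewrite submK//; apply/mnm_lepP.
rewrite mE -add1n; apply: familyD; last by apply: IHn; rewrite m1s.
apply: E1; move: cm; rewrite {1}mE mdegD m1s mulnS; lia.
Qed.

End GradedFamilies.

Section MixedFamilies.
Context {k : fieldType} {R : realType} {d r c : nat}.
Variable J : 'I_r -> nat -> set (mpoly d k).
Hypotheses (d0 : (0 < d)%N) (gJ : forall i, graded_family (J i)) (c2 : (2 <= c)%N).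
Hypothesis Jc : forall i, ideal_exp (max_ideal k d) (c - 1)%N `<=` J i 1%N.

Definition mixed_exponents (n : 'I_r -> nat) : set (multinom d) :=
  [set m | exists2 q : 'I_r -> multinom d,
    forall i, exponents (J i (n i)) (q i) & forall j, (\sum_i q i j <= m j)%N].

Lemma exponents_neq0 i n : exponents (J i n) !=set0.
Proof.
exists (Multinom [tuple (if j == Ordinal d0 then c.-1 * n else 0)%N | j < d]).
apply: (family_deg (gJ i) c2 (@Jc i)).
by rewrite mdegE (bigD1 (Ordinal d0))//= mnmE eqxx leq_addr.
Qed.

Lemma mixed_idealE n : upset (mixed_exponents n) /\
  mixed_ideal J n = monomial_span (mixed_exponents n).
Proof.
apply: (ideal_prod_span (I := fun i => J i (n i)) (M := fun i => exponents (J i (n i)))) => i.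
- exact: family_upset (gJ i) _.
- exact: exponents_neq0.
- exact: family_span (gJ i) _.
Qed.

(** Split the exponent into parts of degrees (c-1) n i. *)
Lemma mixed_exponents_deg n m : (c.-1 * \sum_i n i <= mdeg m)%N -> mixed_exponents n m.
Proof.
rewrite big_distrr/= => nm.
have [q qn qm] := exists_split_degrees (index_enum_uniq 'I_r) nm.
exists q => // i; apply: (family_deg (gJ i) c2 (@Jc i)).
by rewrite qn// mem_index_enum.
Qed.

(** For the basis vector e_i all factors but the i-th one are the whole ring. *)
Lemma Gamma_mnm1 i : Gamma c J (mnm1 i) = bounded_semigroup c (fun n => exponents (J i n)).
Proof.
apply/seteqP; split=> -[m n]; rewrite /Gamma/bounded_semigroup/= mdeg1 muln1 => -[H Hc]; split=> //.
  move: H; have [_ ->] := mixed_idealE (fun h => n * mnm1 i h)%N.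
  move=> /monomial_span_X[q Eq qm]; have := Eq i; rewrite mnm1E eqxx muln1 => Eqi.
  apply: family_upset (gJ i) _ _ _ Eqi _ => j; apply: leq_trans (qm j).
  by rewrite (bigD1 i)//= leq_addr.
have [_ ->] := mixed_idealE (fun h => n * mnm1 i h)%N.
apply/monomial_span_X; exists (fun h => if h == i then m else mnm0) => [h|j].
  rewrite mnm1E eq_sym; case: eqP => [->|_]; first by rewrite muln1.
  by rewrite muln0 (family0 (gJ h)).
rewrite (bigD1 i)//= eqxx big1 ?addn0// => h /negbTE->.
by rewrite mnm0E.
Qed.

Local Notation D i := (@Delta R d (Gamma c J (mnm1 i))).

Lemma body_Delta i : convex_body (D i).
Proof.
rewrite Gamma_mnm1; apply: Delta_convex_body => //.
by move=> n m; exact: (family_deg (gJ i) c2 (@Jc i)).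
Qed.

Variable n : multinom r.
Local Notation K := (minkowski_comb (fun i => (n i)%:R) (fun i => D i)).
Local Notation MX := (fun m => mixed_exponents (fun i => m * n i)%N).

(** Write p as a sum of exponents of the factors and redistribute so that the i-th summand
    has degree at most c m n_i; divided by m n_i it becomes a point of the i-th body. *)
Lemma mixed_in_body m p : (0 < m)%N -> MX m p -> (mdeg p <= c * m * mdeg n)%N ->
  K (\row_j ((p j)%:R / m%:R)).
Proof.
move=> m0 [q0 Eq0 q0p] pc.
have /choice[y0 Dy0] : forall i, exists y, D i y by move=> i; have [] := body_Delta i.
have [q [Eq qp]] : exists q : 'I_r -> multinom d,
    (forall i, exponents (J i (m * n i)%N) (q i)) /\ forall j, (\sum_i q i j = p j)%N.
  have [i0 _|nor] := pickP 'I_r; last first.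
    exists q0; split=> // j; rewrite big1 => [|i _]; last by have := nor i.
    have : mdeg p = 0%N.
      apply/eqP; rewrite -leqn0 (leq_trans pc)// mdegE big1 ?muln0// => i _; by have := nor i.
    by move=> /eqP; rewrite mdeg_eq0 => /eqP->; rewrite mnm0E.
  exists (fun i => if i == i0 then Multinom [tuple (q0 i0 j + (p j - \sum_i q0 i j))%N | j < d] else q0 i).
  split=> [i|j].
    case: eqP => // ->; apply: family_upset (gJ i0) _ _ _ (Eq0 i0) _ => j.
    by rewrite mnmE leq_addr.
  rewrite (bigD1 i0)//= (eq_bigr (fun i => q0 i j)); last by move=> i /negbTE ->.
  have sE : (\sum_i q0 i j = q0 i0 j + \sum_(i < r | i != i0) q0 i j)%N by rewrite (bigD1 i0).
  by rewrite eqxx mnmE addnAC -sE subnKC.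
have [i|i m' cm|i||q' [Eq' q'c q's]] := @redistribute d r (fun i => exponents (J i (m * n i)%N))
    (fun i => c * (m * n i))%N q.
- exact: family_upset (gJ i) _.
- apply: (family_deg (gJ i) c2 (@Jc i)); apply: leq_trans cm.
  by rewrite leq_mul2r leq_pred orbT.
- exact: Eq.
- under eq_bigr do rewrite mdegE; rewrite exchange_big/=.
  rewrite (eq_bigr (fun j => p j)) => [|j _]; last exact: qp.
  by rewrite -mdegE (leq_trans pc)// mdegE -!big_distrr/= mulnA.
exists (fun i => if (0 < n i)%N then \row_j ((q' i j)%:R / (m * n i)%:R) else y0 i) => [i|].
  case: ifP => // ni; rewrite Gamma_mnm1; apply: Delta_quotient; last by rewrite muln_gt0 m0.
  by split; [exact: Eq'|exact: q'c].
apply/rowP => j; rewrite mxE summxE -qp -q's natr_sum mulr_suml; apply: eq_bigr => i _.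
rewrite mxE; case: ifP => ni.
  rewrite mxE natrM; field.
  by rewrite !pnatr_eq0 -!lt0n ni m0.
have n0 : n i = 0%N by move: ni; case: (n i).
have : (q' i j <= 0)%N.
  by apply: leq_trans (_ : mdeg (q' i) <= 0)%N;
    [rewrite mdegE (bigD1 j)//= leq_addr | have := q'c i; rewrite n0 !muln0].
by rewrite leqn0 => /eqP->; rewrite n0 !mul0r.
Qed.

(** Split p according to a decomposition of z, rounding each summand up; the total
    rounding error, at most r, is negligible with respect to m eta. *)
Lemma above_body_mixed eta : 0 < eta -> exists T : nat, forall m (p : multinom d) z,
  (T <= m)%N -> K z -> (forall j, m%:R * (z 0 j + eta) <= (p j)%:R) -> MX m p.
Proof.
move=> eta0.
(* The e-errors of the n_i copies of each body add up to at most eta / 2. *)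
pose e := eta / (2 * (mdeg n).+1%:R).
have e0 : 0 < e by rewrite divr_gt0// mulr_gt0.
have /choice[T TP] : forall i, exists T : nat, forall m (p : multinom d) y, (T <= m)%N -> D i y ->
    (forall j, m%:R * (y 0 j + e) <= (p j)%:R) -> exponents (J i m) p.
  move=> i; rewrite Gamma_mnm1; apply: Delta_above_uniform => //.
  - by apply: leq_trans c2.
  - exact: family_upset (gJ i).
  - exact: family0 (gJ i).
  - exact: familyD (gJ i).
  - exact: (family_deg (gJ i) c2 (@Jc i)).
exists (maxn (\max_i T i) (Num.truncn (2 * r%:R / eta)).+1)%N => m p z; rewrite geq_max => /andP[mT mr].
move=> [y Dy ->] zp.
pose q i : multinom d := if (0 < n i)%N then
  Multinom [tuple (Num.truncn ((m * n i)%:R * (y i 0 j + e))).+1 | j < d] else mnm0.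
exists q => [i|j].
  rewrite /q; case: ifP => ni; last first.
    have -> : n i = 0%N by move: ni; case: (n i).
    by rewrite muln0 (family0 (gJ i)).
  apply: (TP i _ _ (y i)) => [||j]; [|exact: Dy|].
    apply: leq_trans (leq_pmulr m ni); apply: leq_trans mT; exact: leq_bigmax.
  by rewrite mnmE; apply/ltW; exact: truncnS_gt.
rewrite -(ler_nat R) natr_sum; apply: le_trans (zp j).
have y0 i : 0 <= y i 0 j.
  by have := Dy i; rewrite Gamma_mnm1 => /(Delta_bounds d0)[].
apply: (@le_trans _ _ (\sum_i (m%:R * ((n i)%:R * y i 0 j) + m%:R * (n i)%:R * e + 1))).
  apply: ler_sum => i _; rewrite /q; case: ifP => ni; last first.
    by rewrite mnm0E !addr_ge0// !mulr_ge0// ltW.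
  rewrite mnmE -natr1 lerD2r.
  have ge0 : 0 <= (m * n i)%:R * (y i 0 j + e) by rewrite mulr_ge0// addr_ge0// ltW.
  have /andP[h _] := truncn_itv ge0; apply: (le_trans h).
  by rewrite natrM; lra.
rewrite !big_split/= sumr_const card_ord -mulr_sumr -mulr_suml -mulr_sumr -natr_sum -mdegE.
have -> : (\sum_i (n i)%:R *: y i) 0 j = \sum_i (n i)%:R * y i 0 j.
  by rewrite summxE; apply: eq_bigr => i _; rewrite mxE.
have h1 : (mdeg n)%:R * e <= eta / 2.
  have nE : (mdeg n).+1%:R = (mdeg n)%:R + 1 :> R by rewrite natr1.
  by rewrite /e mulrA ler_pdivrMr ?mulr_gt0// nE; lra.
have h2 : r%:R <= m%:R * (eta / 2).
  have : 2 * r%:R / eta <= m%:R.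
    by apply/ltW/(lt_le_trans (truncnS_gt _)); rewrite ler_nat.
  by rewrite ler_pdivrMr//; lra.
have h3 : m%:R * ((mdeg n)%:R * e) <= m%:R * (eta / 2) by rewrite ler_wpM2l.
rewrite mulrDr -addrA lerD2l; lra.
Qed.

End MixedFamilies.

(** * Asymptotic colength *)

Section Colengths.
Context {k : fieldType} {R : realType} {d r c : nat}.
Variable J : 'I_r -> nat -> set (mpoly d k).
Hypotheses (d0 : (0 < d)%N) (gJ : forall i, graded_family (J i)) (c2 : (2 <= c)%N).
Hypothesis Jc : forall i, ideal_exp (max_ideal k d) (c - 1)%N `<=` J i 1%N.
Variable n : multinom r.

Local Notation D i := (@Delta R d (Gamma c J (mnm1 i))).
Local Notation K := (minkowski_comb (fun i => (n i)%:R) (fun i => D i)).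
Local Notation MX m := (mixed_exponents J (fun i => m * n i)%N).
Local Notation simplex s := [set p : multinom d | (mdeg p <= s)%N].
Let A := (c * mdeg n)%N.

Lemma complement_sub m : ~` MX m `<=` simplex (A * m).
Proof.
move=> p nMX; rewrite /= leqNgt; apply/negP => pA; apply: nMX.
apply: (mixed_exponents_deg gJ c2 (@Jc)); rewrite -big_distrr/= -mdegE.
apply: leq_trans (ltnW pA); rewrite /A -mulnA [(mdeg n * m)%N]mulnC.
by rewrite leq_mul2r leq_pred orbT.
Qed.

Lemma finite_complement m : finite_set (~` MX m).
Proof. by have [fs _] := ncard_simplex (d := d) (A * m); exact: sub_finite_set (@complement_sub m) fs. Qed.

Lemma quotient_dimE m : quotient_dim (mixed_ideal J (fun i => m * n i)%N) = ncard (~` MX m).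
Proof.
have [uM ->] := mixed_idealE d0 gJ c2 (@Jc) (fun i => m * n i)%N.
exact: quotient_dim_span uM (@finite_complement m).
Qed.

Lemma bounded_body_sum : bounded_by (\sum_i (n i)%:R * c%:R) K.
Proof.
apply: bounded_comb => // i; rewrite Gamma_mnm1//; exact: Delta_bounded.
Qed.

(** Exponents of degree at most A m are outside the ideal, or are m times points of K. *)
Lemma colength_lower m delta : (0 < m)%N -> 0 <= delta ->
  ('C(d + A * m, d) <= ncard (~` MX m) + ncard (thick m%:R delta K))%N.
Proof.
move=> m0 de0; have [fs <-] := ncard_simplex (d := d) (A * m).
rewrite (ncardID (MX m) fs) addnC leq_add//.
  by apply: ncard_le; [exact: finite_complement | move=> p []].
pose f (p : multinom d) : 'rV[int]_d := \row_j (p j)%:Z.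
have fi : {in simplex (A * m) `&` MX m &, injective f}.
  move=> p q _ _ /rowP pq; apply/mnmP => j; have := pq j; by rewrite !mxE => -[].
rewrite -(ncard_inj _ fi); last by apply: finite_setI; left.
apply: ncard_le; first exact: finite_thick bounded_body_sum.
move=> _ [p [pA Mp] <-]; exists (\row_j ((p j)%:R / m%:R)).
  by apply: mixed_in_body => //; rewrite mulnAC.
move=> j; rewrite !mxE mulrCA mulfV ?mulr1; last by rewrite pnatr_eq0 -lt0n.
by rewrite -pmulrn subrr normr0 mulr_ge0.
Qed.

(** Translating floors m K by the constant vector u gives exponents of the ideal, of degree
    at most A m + d u, hence disjoint from the complement of the ideal. *)
Lemma colength_upper (eta : R) : 0 < eta -> exists T : nat, forall m u, (T <= m)%N ->
  m%:R * eta + 1 <= u%:R ->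
  (ncard (floors m%:R K) + ncard (~` MX m) <= 'C(d + (A * m + d * u), d))%N.
Proof.
move=> eta0; have [T TP] := above_body_mixed d0 gJ c2 (@Jc) n eta0.
exists T => m u Tm um; have [fs <-] := ncard_simplex (d := d) (A * m + d * u).
rewrite (ncardID (MX m) fs) leq_add//; last first.
  apply: ncard_le; first by apply: finite_setI; left.
  by move=> p nM; split=> //; rewrite /= (leq_trans (complement_sub nM))// leq_addr.
pose g (f : 'rV[int]_d) : multinom d := Multinom [tuple (`|f 0%R j| + u)%N | j < d].
have K0 (z : 'rV[R]_d) : K z -> (forall j, 0 <= z 0 j) /\ \sum_j z 0 j <= A%:R.
  move=> [y Dy ->].
  have yP i := Delta_bounds (R := R) d0 (c := c) (E := fun n => exponents (J i n)) (y := y i).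
  have {}yP i : (forall j, 0 <= y i 0 j) /\ \sum_j y i 0 j <= c%:R.
    by apply: yP; rewrite -Gamma_mnm1.
  split=> [j|].
    by rewrite summxE sumr_ge0// => i _; rewrite mxE mulr_ge0//; have [] := yP i.
  under eq_bigr do rewrite summxE; rewrite exchange_big/=.
  apply: (@le_trans _ _ (\sum_i (n i)%:R * c%:R)).
    apply: ler_sum => i _; rewrite (eq_bigr (fun j => (n i)%:R * y i 0 j)); last by move=> j _; rewrite mxE.
    by rewrite -mulr_sumr ler_wpM2l//; have [] := yP i.
  by rewrite -mulr_suml -natr_sum -mdegE /A natrM mulrC.
have fl0 (z : 'rV[R]_d) j : K z -> 0 <= Num.floor (m%:R * z 0 j).
  by move=> Kz; rewrite floor_ge_int mulr_ge0//; have [] := K0 z Kz.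
have gi : {in floors m%:R K &, injective g}.
  move=> _ _ /set_mem[x Kx <-] /set_mem[y Ky <-] /mnmP fg; apply/rowP => j.
  have := fg j; rewrite !mnmE !mxE => /addIn xy.
  by rewrite -(gez0_abs (fl0 x j Kx)) -(gez0_abs (fl0 y j Ky)) xy.
rewrite -(ncard_inj _ gi); last exact: finite_floors bounded_body_sum.
apply: ncard_le; first by apply: finite_setI; left.
move=> _ [_ [z Kz <-] <-].
have gE j : (g (floor_vec (m%:R *: z)) j)%:R = (Num.floor (m%:R * z 0 j))%:~R + u%:R :> R.
  rewrite mnmE natrD !mxE; congr (_ + _).
  by rewrite -[in RHS](gez0_abs (fl0 z j Kz)).
split.
  rewrite /= -(ler_nat R) mdegE natr_sum (eq_bigr (fun j => (Num.floor (m%:R * z 0 j))%:~R + u%:R)); last first.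
    by move=> j _; exact: gE.
  rewrite big_split/= sumr_const card_ord natrD natrM lerD//; last by rewrite natrM mulr_natl.
  have [_ zA] := K0 z Kz; apply: (@le_trans _ _ (\sum_j m%:R * z 0 j)).
    by apply: ler_sum => j _; exact: floor_le.
  by rewrite -mulr_sumr mulrC ler_wpM2r.
apply: (TP m _ z Tm Kz) => j; rewrite gE.
have /andP[_ h] := floor_itv (m%:R * z 0 j); rewrite intrD in h.
rewrite mulrDr; lra.
Qed.

(** Both estimates, with eta and delta chosen in terms of the error, and the number
    of exponents of degree at most s being asymptotic to s^d / d!. *)
Lemma cvg_colength :
  (fun m : nat => (ncard (~` MX m))%:R / m%:R ^+ d : R) @ \oo -->
  A%:R ^+ d / d`!%:R - Vol K.
Proof.
have fact0 : 0 < d`!%:R :> R by rewrite ltr0n fact_gt0.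
have bD i : convex_body (D i) by exact: body_Delta.
have cK : compact K by apply: compact_comb => i; have [] := bD i.
apply/cvgrPdist_le => eps eps0.
have [delta de0 [t0 t00 tP]] := thick_le_Vol d0 cK eps0.
have [h h0] := prod_widen (fun _ : 'I_d => A%:R) (mulr_gt0 fact0 eps0).
rewrite !prodr_const card_ord => hP.
have dR : 0 < d%:R :> R by rewrite ltr0n.
(* The shift by u in colength_upper raises degrees by d u, which is about m h. *)
pose eta := h / d%:R; have eta0 : 0 < eta by rewrite divr_gt0.
have [T TP] := colength_upper eta0.
near=> m.
have m0 : (0 < m)%N by near: m; exact: nbhs_infty_gt.
have mR : 0 < m%:R :> R by rewrite ltr0n.
have md0 : 0 < m%:R ^+ d :> R by rewrite exprn_gt0.
rewrite distrC ler_distl; apply/andP; split.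
  rewrite ler_pdivlMr//.
  have ct : (ncard (thick m%:R delta K))%:R <= m%:R ^+ d * (Vol K + eps).
    by apply: tP; near: m; exact: nbhs_infty_ger.
  have := colength_lower m0 (ltW de0); rewrite -(ler_nat R) natrD => h1.
  have [h2 _] := @bin_bounds d R (A * m).
  have h3 : A%:R ^+ d / d`!%:R * m%:R ^+ d <= 'C(d + A * m, d)%:R :> R.
    by rewrite mulrAC ler_pdivrMr// -exprMn -natrM [leRHS]mulrC.
  lra.
rewrite ler_pdivrMr//.
pose u := (Num.truncn (m%:R * eta)).+2.
have um : m%:R * eta + 1 <= u%:R <= m%:R * eta + 2.
  have me0 : 0 <= m%:R * eta by rewrite mulr_ge0 ?ltW.
  have /andP[h1 h2] := truncn_itv me0.
  rewrite /u -[_.+2%:R]natr1; rewrite -natr1 in h2 *.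
  by apply/andP; split; lra.
have Tm : (T <= m)%N by near: m; exact: nbhs_infty_ge.
have /andP[um1 um2] := um.
have := TP m u Tm um1; rewrite -(ler_nat R) natrD => h1.
have h2 := Vol_le_floors d0 bounded_body_sum mR.
have [_ h3] := @bin_bounds d R (A * m + d * u).
have h4 : ((A * m + d * u + d)%:R : R) ^+ d <= m%:R ^+ d * (A%:R ^+ d + d`!%:R * eps).
  apply: (@le_trans _ _ (m%:R ^+ d * (A%:R + 5 * h) ^+ d)); last first.
    by rewrite ler_wpM2l// ltW.
  have s0 : 0 <= A%:R + 5 * h by rewrite addr_ge0// mulr_ge0// ltW.
  rewrite -exprMn lerXn2r ?nnegrE// ?mulr_ge0//.
  rewrite !natrD !natrM.
  have h5 : d%:R * u%:R <= m%:R * h + 2 * d%:R.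
    apply: (@le_trans _ _ (d%:R * (m%:R * eta + 2))); first by rewrite ler_wpM2l.
    by rewrite mulrDr /eta mulrCA [d%:R * (h / _)]mulrCA mulfV ?mulr1 ?gt_eqF// lerD2l mulrC.
  have h6 : 3 * d%:R / h <= m%:R by near: m; exact: nbhs_infty_ger.
  rewrite ler_pdivrMr// in h6.
  have h7 : 0 <= m%:R * h by rewrite mulr_ge0 ?ltW.
  lra.
have h5 : ('C(d + (A * m + d * u), d)%:R : R) <= m%:R ^+ d * (A%:R ^+ d / d`!%:R + eps).
  rewrite -(ler_pM2l fact0); apply: (le_trans h3); apply: (le_trans h4).
  rewrite mulrCA ler_wpM2l ?(ltW md0)// [leRHS]mulrDr.
  by rewrite [X in _ <= X + _]mulrC divfK// gt_eqF.
lra.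
Unshelve. all: by end_near. Qed.

End Colengths.

Theorem theorem3p5 (k : fieldType) (R : realType) (d r c : nat)
    (J : 'I_r -> nat -> set (mpoly d k))
    (d_ge1 : (1 <= d)%N)
    (J_graded : forall i, graded_family (J i))
    (c_ge2 : (2 <= c)%N)
    (J_contains : forall i, ideal_exp (max_ideal k d) (c - 1)%N `<=` J i 1%N) :
  exists G : mpoly r R,
    [/\ G \is ishomog1 d (@mdeg r),
        G = \sum_(a : bmultinom r d.+1 | mdeg a == d)
              ((mnm_fact a)%:R^-1 *
               (c%:R ^+ d -
                mixed_volume
                  (repeat_bodies (fun i => Delta (Gamma c J (mnm1 i))) a)))
              *: mpolyX R a
      & forall n : multinom r,
          (fun m : nat =>
             (quotient_dim (mixed_ideal J (fun i => m * n i)%N))%:R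
               / m%:R ^+ d : R) @ \oo --> meval (fun i => (n i)%:R) G].
Proof.
eexists; split; [|reflexivity|].
  apply: rpred_sum => a /eqP ad; apply: rpredZ.
  by apply/allP => m; rewrite msuppX mem_seq1 => /eqP->; rewrite /= ad.
move=> n.
have bD i : convex_body (@Delta R d (Gamma c J (mnm1 i))) by exact: body_Delta.
have [_ MV] := mixed_volumeP (R := R) d_ge1.
have E : meval (fun i => (n i)%:R) (\sum_(a : bmultinom r d.+1 | mdeg a == d)
     ((mnm_fact a)%:R^-1 * (c%:R ^+ d - mixed_volume
        (repeat_bodies (fun i => @Delta R d (Gamma c J (mnm1 i))) a))) *: mpolyX R a) =
   (c * mdeg n)%:R ^+ d / d`!%:R -
   Vol (minkowski_comb (fun i => (n i)%:R) (fun i => @Delta R d (Gamma c J (mnm1 i)))).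
  rewrite raddf_sum/= (MV r _ (fun i => (n i)%:R) bD)//.
  have -> : (c * mdeg n)%:R ^+ d / d`!%:R = \sum_(a : bmultinom r d.+1 | mdeg a == d)
      (mnm_fact a)%:R^-1 * (c%:R ^+ d * \prod_i (n i)%:R ^+ a i) :> R.
    rewrite natrM exprMn mdegE natr_sum.
    have -> : (\sum_i (n i)%:R) ^+ d = \sum_(f : {ffun 'I_d -> 'I_r}) \prod_j (n (f j))%:R :> R.
      by rewrite -{1}(card_ord d) -prodr_const bigA_distr_bigA.
    rewrite (eq_bigr (fun f : {ffun 'I_d -> 'I_r} =>
      (fun a : multinom r => \prod_i (n i)%:R ^+ a i : R) (content f))); last first.
      by move=> f _; rewrite (prod_content f (fun i => (n i)%:R)).
    rewrite (@sum_content r R d (fun a => \prod_i (n i)%:R ^+ a i)).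
    rewrite mulrCA [d`!%:R * _]mulrC mulfK; last by rewrite pnatr_eq0 -lt0n fact_gt0.
    by rewrite mulr_sumr; apply: eq_bigr => a _; rewrite mulrCA.
  rewrite -sumrB; apply: eq_bigr => a _; rewrite mevalZ mevalX; ring.
rewrite E.
have -> : (fun m : nat => (quotient_dim (mixed_ideal J (fun i => m * n i)%N))%:R / m%:R ^+ d : R) =
    fun m : nat => (ncard (~` mixed_exponents J (fun i => m * n i)%N))%:R / m%:R ^+ d.
  by apply/funext => m; rewrite (quotient_dimE d_ge1 J_graded c_ge2 J_contains).
exact: cvg_colength.
Qed.
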